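(* Consider, along a sequence with $n,r\to\infty$ and $p$ fixed, the multivariate linear model $Y=\alpha+\beta X+\varepsilon$ with $X\in\mathbb{R}^p$, $Y\in\mathbb{R}^r$, $\varepsilon$ independent of $X$, $E(X)=0$, $E(Y)=0$, and a fixed $\sigma>0$ such that for every $w\in\mathbb{R}^{p+r}$ with $\|w\|_2=1$ and $t\ge0$, $P(|w^{T}(X^{T},Y^{T})^{T}|\ge t)\le2\exp(-t^2/\sigma^2)$. Let $M=\Sigma_Y$, $U=\Sigma_{YX}\Sigma_{XY}$ and, from $n$ i.i.d. copies of $(X,Y)$, $\widehat M=\widehat\Sigma_Y$, $\widehat U=\widehat\Sigma_{YX}\widehat\Sigma_{XY}$. Let $\mathcal{E}=\mathcal{E}_M(U)\subseteq\mathbb{R}^r$, of dimension $u$; assume $d,u$ are fixed, $\mathcal{E}\subseteq\mathrm{span}(v_1,\dots,v_d)$, and $\Delta=\min_{1\le j\le d}(\lambda_j-\lambda_{j+1})$ is bounded away from $0$. Let $\Delta_U$ be the envelope score gap and $\widehat{\mathcal{E}}$ the sparse NIECE subspace with $\ell_1$-bound $\tau>\tau_0=\max_{1\le k\le d}\|v_k\|_1$. If $\log r=o(n)$ and $\Delta_U$ and $\tau$ satisfy $$\max\left(\tau^2\sqrt{\log r},\ \Delta_U^{-2}\tau^2\sqrt{\log r}\right)=o(\sqrt n),$$ then $\|P_{\widehat{\mathcal{E}}}-P_{\mathcal{E}}\|_F\to0$ in probability as $n,r\to\infty$.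
   Context: $\Sigma_Y$ (positive definite) is the covariance of $Y$ and $\Sigma_{YX}=\Sigma_{XY}^{T}$ the cross-covariance; $\widehat\Sigma_Y=n^{-1}\sum_iY_iY_i^{T}$ and $\widehat\Sigma_{YX}=\widehat\Sigma_{XY}^{T}=n^{-1}\sum_iY_iX_i^{T}$. $\|A\|_F$ is the Frobenius norm; $P_{\mathcal{S}}$ is the orthogonal projection onto $\mathcal{S}$. $\lambda_1\ge\dots\ge\lambda_r$ are the eigenvalues of $M$ and $v_1,\dots,v_r$ corresponding orthonormal eigenvectors. A reducing subspace of $M$ is a subspace $\mathcal{R}$ with $M=P_{\mathcal{R}}MP_{\mathcal{R}}+(I-P_{\mathcal{R}})M(I-P_{\mathcal{R}})$. $\mathcal{E}_M(U)$ is the intersection of all reducing subspaces of $M$ that contain the column space $\mathrm{span}(U)$. Envelope scores: $\phi_j=v_j^{T}Uv_j$, $j\le d$, sorted as $\phi_{(1)}\ge\dots\ge\phi_{(d)}$. Under the assumptions exactly the first $u\ge1$ sorted scores are positive, the corresponding eigenvectors span $\mathcal{E}_M(U)$, and $\Delta_U=\phi_{(u)}>0$. PMD vectors of $\widehat M$ with bound $\tau$: set $\widehat M_1=\widehat M$; for $k=1,\dots,d$, $\widehat v_k$ is a maximizer of $v^{T}\widehat M_kv$ subject to $\|v\|_1\le\tau$ and $\|v\|_2^2\le1$, and $\widehat M_{k+1}=(I-\widehat v_k\widehat v_k^{T})\widehat M_k(I-\widehat v_k\widehat v_k^{T})$. Sparse NIECE subspace: compute $\widehat\phi_j=\widehat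 v_j^{T}\widehat U\widehat v_j$ for $j\le d$; $\widehat{\mathcal{E}}$ is the span of the $u$ vectors $\widehat v_j$ with the largest $\widehat\phi_j$. *)

(* Defs.v *)
From HB Require Import structures.
From mathcomp Require Import all_boot all_order all_algebra.
From mathcomp Require Import all_classical all_reals all_analysis.
Set Implicit Arguments. Unset Strict Implicit. Unset Printing Implicit Defensive.
Import Order.TTheory GRing.Theory Num.Theory.
Import numFieldNormedType.Exports.
Local Open Scope classical_set_scope.
Local Open Scope ring_scope.

(* Vectors are columns.  A subspace of R^r is encoded, as in mxalgebra, by a
   square matrix whose ROW space is that subspace: the line spanned by a column
   v is <<v^T>>%MS, and the column space of U is the row space of U^T. *)

Section LinearAlgebra.
Variable R : realType.

Definition quad r (A : 'M[R]_r) (v : 'cV[R]_r) : R := (v^T *m A *m v) 0 0.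

Definition l1norm r (v : 'cV[R]_r) : R := \sum_i `|v i 0|.

Definition l2norm r (v : 'cV[R]_r) : R := Num.sqrt (\sum_i v i 0 ^+ 2).

Definition frobenius m n (A : 'M[R]_(m, n)) : R :=
  Num.sqrt (\sum_i \sum_j A i j ^+ 2).

Definition posdef r (A : 'M[R]_r) : Prop :=
  A^T = A /\ forall v : 'cV[R]_r, v != 0 -> 0 < quad A v.

(* Projection onto S parallel to its orthogonal complement {x | x S^T = 0}.
   proj_mx acts on row vectors from the right, but an orthogonal projector is
   symmetric, so the same matrix acts on columns from the left. *)
Definition orthproj r (S : 'M[R]_r) : 'M[R]_r := proj_mx S (kermx S^T).

Definition reducing r (M S : 'M[R]_r) : Prop :=
  let P := orthproj S in
  M = P *m M *m P + (1%:M - P) *m M *m (1%:M - P).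

(* Intersection of an arbitrary family of subspaces of R^r. *)
Definition mxbigcap r (F : set 'M[R]_r) : 'M[R]_r :=
  xget 0 [set E : 'M[R]_r | forall x : 'rV[R]_r,
    (x <= E)%MS <-> forall S, F S -> (x <= S)%MS].

Lemma sub_mxbigcap r (F : set 'M[R]_r) (x : 'rV[R]_r) :
  (x <= mxbigcap F)%MS <-> forall S, F S -> (x <= S)%MS.
Proof.
suff [E EP] : exists E : 'M[R]_r, forall x : 'rV[R]_r,
    (x <= E)%MS <-> forall S, F S -> (x <= S)%MS.
  by rewrite /mxbigcap; case: xgetP => [y _ yP|/(_ E)]//; exact: yP.
pose G (s : seq 'M[R]_r) := (\bigcap_(S <- s) S)%MS.
pose Fs (s : seq 'M[R]_r) := forall S, S \in s -> F S.
pose Q k := `[< exists2 s, Fs s & \rank (G s) = k >].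
have exQ : exists k, Q k by exists (\rank (G [::])); apply/asboolP; exists [::].
case: (ex_minnP exQ) => k /asboolP[s sF sk] kmin.
exists (G s) => y; split=> [yG S FS|yF].
  have GSs : (G (S :: s) <= G s)%MS by rewrite /G big_cons capmxSr.
  have : (G s <= G (S :: s))%MS.
    rewrite -(geq_leqif (mxrank_leqif_sup GSs)) sk; apply: kmin.
    apply/asboolP; exists (S :: s) => // A.
    by rewrite in_cons => /predU1P[->//|/sF].
  rewrite {2}/G big_cons sub_capmx => /andP[GS _].
  exact: submx_trans yG GS.
rewrite /G; elim: s sF {sk} => [_|S s IH sF]; first by rewrite big_nil submx1.
rewrite big_cons sub_capmx yF /=; last by apply: sF; rewrite mem_head.
by apply: IH => A As; apply: sF; rewrite in_cons As orbT.
Qed.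

Definition envelope r (M U : 'M[R]_r) : 'M[R]_r :=
  mxbigcap [set S | reducing M S /\ (U^T <= S)%MS].

Definition eigensystem r (M : 'M[R]_r) (lam : 'I_r -> R)
    (v : 'I_r -> 'cV[R]_r) : Prop :=
  [/\ forall i j : 'I_r, (i <= j)%N -> lam j <= lam i,
      forall i j : 'I_r, ((v i)^T *m v j) 0 0 = (i == j)%:R
    & forall j : 'I_r, M *m v j = lam j *: v j].

(* max_(1 <= j <= d) |v_j|_1 ; indices start at 0 here. *)
Definition max_l1norm r (d : nat) (v : 'I_r -> 'cV[R]_r) : R :=
  \big[Num.max/0]_(j < r | (j < d)%N) l1norm (v j).

(* The u-th largest of the scores v_j^T U v_j, j = 1..d. *)
Definition score_gap r (d u : nat) (U : 'M[R]_r) (v : 'I_r -> 'cV[R]_r) : R :=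
  nth 0 (sort >=%R
    [seq quad U (v j) | j : 'I_r <- enum 'I_r & (j < d)%N]) u.-1.

(* Only the first d values of the sequence vh of vectors are meaningful. *)
Fixpoint deflated r (A : 'M[R]_r) (vh : nat -> 'cV[R]_r) (k : nat) : 'M[R]_r :=
  if k is k'.+1 then
    let Q := 1%:M - vh k' *m (vh k')^T in Q *m deflated A vh k' *m Q
  else A.

Definition PMD_feasible r (tau : R) (v : 'cV[R]_r) : Prop :=
  l1norm v <= tau /\ l2norm v ^+ 2 <= 1.

Definition PMD r (d : nat) (tau : R) (A : 'M[R]_r) (vh : nat -> 'cV[R]_r) :
    Prop :=
  forall k, (k < d)%N -> PMD_feasible tau (vh k) /\
    forall w, PMD_feasible tau w ->
      quad (deflated A vh k) w <= quad (deflated A vh k) (vh k).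

(* E is an output of sparse NIECE: neither the PMD maximizers nor, in case of
   ties among scores, the selected u vectors need be unique. *)
Definition sparse_NIECE r (d u : nat) (tau : R) (Mh Uh E : 'M[R]_r) : Prop :=
  exists2 vh : nat -> 'cV[R]_r, PMD d tau Mh vh &
  exists J : {set 'I_d},
    [/\ #|J| = u,
        forall i j, i \in J -> j \notin J -> quad Uh (vh j) <= quad Uh (vh i)
      & (E :=: \sum_(j in J) <<(vh j)^T>>)%MS].

Definition sample_cov n a b (Z : 'I_n -> 'cV[R]_a) (W : 'I_n -> 'cV[R]_b) :
    'M[R]_(a, b) :=
  n%:R^-1 *: \sum_i Z i *m (W i)^T.

End LinearAlgebra.

Section Probability.
Variable R : realType.

Definition borel m : set (set 'cV[R]_m) := <<s [set A : set 'cV[R]_m | open A] >>.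

Section OneSpace.
Variables (disp : measure_display) (T : measurableType disp) (P : probability T R).

Definition random_vector m (Z : T -> 'cV[R]_m) : Prop :=
  forall B, borel B -> measurable (Z @^-1` B).

Definition independent_vectors a b (Z : T -> 'cV[R]_a) (W : T -> 'cV[R]_b) :
    Prop :=
  forall A B, borel A -> borel B ->
    P (Z @^-1` A `&` W @^-1` B) = (P (Z @^-1` A) * P (W @^-1` B))%E.

(* Taking some A i to be the whole space gives the product rule for every
   subfamily. *)
Definition mutually_independent n m (Z : 'I_n -> T -> 'cV[R]_m) : Prop :=
  forall A : 'I_n -> set 'cV[R]_m, (forall i, borel (A i)) ->
    P [set t | forall i, A i (Z i t)] = (\prod_i P (Z i @^-1` A i))%E.

Definition iid_copies n m (Z : T -> 'cV[R]_m) (Zs : 'I_n -> T -> 'cV[R]_m) :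
    Prop :=
  [/\ forall i, random_vector (Zs i),
      forall i B, borel B -> P (Zs i @^-1` B) = P (Z @^-1` B)
    & mutually_independent Zs].

Definition centered m (Z : T -> 'cV[R]_m) : Prop :=
  forall i, ('E_P[fun t => Z t i 0%R] = 0)%E.

Definition cross_cov a b (Z : T -> 'cV[R]_a) (W : T -> 'cV[R]_b) : 'M[R]_(a, b) :=
  \matrix_(i, j) fine (covariance P (fun t => Z t i 0) (fun t => W t j 0)).

Definition sub_gaussian m (sigma : R) (Z : T -> 'cV[R]_m) : Prop :=
  forall w : 'cV[R]_m, l2norm w = 1 -> forall t : R, 0 <= t ->
    (P [set x | (t <= `|(w^T *m Z x) 0 0|)%R]
       <= (2 * expR (- (t ^+ 2 / sigma ^+ 2)))%R%:E)%E.

End OneSpace.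

(* Convergence to 0 in probability along a sequence of probability spaces.
   The outer measure mu_ext makes this meaningful when the f k are not known to
   be measurable (e.g. when they depend on unspecified choices of maximizers);
   it coincides with P k on measurable sets. *)
Definition cvg0_in_prob (disp : nat -> measure_display)
    (T : forall k, measurableType (disp k)) (P : forall k, probability (T k) R)
    (f : forall k, T k -> R) : Prop :=
  forall e : R, 0 < e ->
    (fun k => mu_ext (P k) [set x | e <= `|f k x|]) @ \oo --> 0%E.

End Probability.

(* Main.v *)
Require Import Defs.
From mathcomp Require Import all_boot all_order all_algebra.
From mathcomp Require Import all_classical all_reals all_analysis.
From mathcomp Require Import finmap measurable_realfun ring lra.
Set Implicit Arguments. Unset Strict Implicit. Unset Printing Implicit Defensive.
Import Order.TTheory GRing.Theory Num.Theory.
Import numFieldNormedType.Exports.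
Local Open Scope classical_set_scope.
Local Open Scope ring_scope.

(* On the event that all entries of the sample second-moment matrix of (X, Y) are
   within t ~ sqrt (log r / n) of their means, the quadratic forms of M and Mh
   differ by at most tau^2 t on the l1-ball, so everything reduces to a
   deterministic perturbation bound in eta = tau^2 t.

   For the PMD vectors vh_k one needs 1 - <vh_k, v_k>^2 = O(eta), linearly in eta:
   scores are then perturbed by O(sqrt eta) = o(Delta_U), which is exactly what
   Delta_U^-2 tau^2 sqrt (log r) = o(sqrt n) allows.  Comparing deflated matrices
   in operator norm would lose a square root at each deflation.  Instead the form
   of the k-th deflated matrix at w is that of Mh at a chain of deflations of w,
   and the optimality of vh_k is compared with the chain started at v_k; along
   both chains the component on v_k drifts only to second order.

   The envelope is spanned by the eigenvectors v_j, j <= d, of positive score: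
   that span is reducing and contains the columns of U, and conversely the
   projector on a reducing subspace commutes with M, so it fixes or kills each
   v_j with simple eigenvalue.  Once the right u indices are selected,
   |P_Eh - P_E|_F^2 <= 2 sum_j (1 - <vh_j, v_j>^2).

   The probability of the event follows from a Chernoff bound for products of
   two sub-Gaussian coordinates and a union bound over (p + r)^2 entries. *)

(** * Inner products and orthonormal bases *)

Section InnerProduct.
Variables (R : realType) (r : nat).
Implicit Types (x y z : 'cV[R]_r) (A : 'M[R]_r).

Definition dotp x y : R := \sum_i x i 0 * y i 0.

Lemma dotpE x y : dotp x y = (x^T *m y) 0 0.
Proof. by rewrite mxE; apply: eq_bigr => i _; rewrite mxE. Qed.

Lemma dotpC x y : dotp x y = dotp y x.
Proof. by apply: eq_bigr => i _; rewrite mulrC. Qed.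

Lemma dotpDl x y z : dotp (x + y) z = dotp x z + dotp y z.
Proof.
by rewrite /dotp -big_split /=; apply: eq_bigr => i _; rewrite mxE mulrDl.
Qed.

Lemma dotpZl a x y : dotp (a *: x) y = a * dotp x y.
Proof. by rewrite /dotp mulr_sumr; apply: eq_bigr => i _; rewrite mxE mulrA. Qed.

Lemma dotpNl x y : dotp (- x) y = - dotp x y.
Proof. by rewrite -scaleN1r dotpZl mulN1r. Qed.

Lemma dotpBl x y z : dotp (x - y) z = dotp x z - dotp y z.
Proof. by rewrite dotpDl dotpNl. Qed.

Lemma dotpDr x y z : dotp x (y + z) = dotp x y + dotp x z.
Proof. by rewrite !(dotpC x) dotpDl. Qed.

Lemma dotpZr a x y : dotp x (a *: y) = a * dotp x y.
Proof. by rewrite !(dotpC x) dotpZl. Qed.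

Lemma dotpBr x y z : dotp x (y - z) = dotp x y - dotp x z.
Proof. by rewrite !(dotpC x) dotpBl. Qed.

Lemma dotpNr x y : dotp x (- y) = - dotp x y.
Proof. by rewrite !(dotpC x) dotpNl. Qed.

Lemma dotp_ge0 x : 0 <= dotp x x.
Proof. by apply: sumr_ge0 => i _; rewrite -expr2 sqr_ge0. Qed.

Lemma dotp_eq0 x : dotp x x = 0 -> x = 0.
Proof.
move=> /eqP; rewrite psumr_eq0 => [/allP x0|i _]; last by rewrite -expr2 sqr_ge0.
apply/matrixP => i j; rewrite ord1 mxE; apply/eqP.
by have := x0 i; rewrite mem_index_enum mulf_eq0 orbb => /(_ isT).
Qed.

Lemma l2norm_sqr x : l2norm x ^+ 2 = dotp x x.
Proof.
rewrite sqr_sqrtr; last by apply: sumr_ge0 => i _; rewrite sqr_ge0.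
by apply: eq_bigr => i _; rewrite expr2.
Qed.

Lemma dotp_CS x y : dotp x y ^+ 2 <= dotp x x * dotp y y.
Proof.
have [y0|y0] := eqVneq (dotp y y) 0.
  rewrite (dotp_eq0 y0) /dotp big1 => [|i _]; last by rewrite mxE mulr0.
  by rewrite expr0n mulr_ge0 // dotp_ge0.
have yp : 0 < dotp y y by rewrite lt_def y0 dotp_ge0.
have := dotp_ge0 (dotp y y *: x - dotp x y *: y).
rewrite dotpBl !dotpBr !dotpZl !dotpZr (dotpC y x) => H.
by rewrite -subr_ge0 -(pmulr_rge0 _ yp); nra.
Qed.

Lemma quadE A x : quad A x = dotp x (A *m x).
Proof. by rewrite dotpE /quad mulmxA. Qed.

Lemma dotp_mulmxl A x y : dotp (A *m x) y = dotp x (A^T *m y).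
Proof. by rewrite !dotpE trmx_mul mulmxA. Qed.

Lemma quadB A x y : A^T = A ->
  quad A (x - y) = quad A x - 2 * dotp x (A *m y) + quad A y.
Proof.
move=> sA; rewrite !quadE mulmxBr dotpBl !dotpBr.
rewrite (dotpC y (A *m x)) dotp_mulmxl sA; ring.
Qed.

Lemma quad_sub A B x : quad (A - B) x = quad A x - quad B x.
Proof. by rewrite /quad mulmxBr mulmxBl !mxE. Qed.

Lemma l1norm_ge0 x : 0 <= l1norm x.
Proof. by apply: sumr_ge0. Qed.

Lemma l1normD x y : l1norm (x + y) <= l1norm x + l1norm y.
Proof.
by rewrite /l1norm -big_split /=; apply: ler_sum => i _; rewrite mxE ler_normD.
Qed.

Lemma l1normZ a x : l1norm (a *: x) = `|a| * l1norm x.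
Proof. by rewrite /l1norm mulr_sumr; apply: eq_bigr => i _; rewrite mxE normrM. Qed.

Lemma dotp_max_l1 x y e : (forall i, `|y i 0| <= e) -> `|dotp x y| <= l1norm x * e.
Proof.
move=> ye; apply: (le_trans (ler_norm_sum _ _ _)).
by rewrite /l1norm mulr_suml; apply: ler_sum => i _; rewrite normrM ler_wpM2l.
Qed.

(** Hölder's inequality, once for each argument. This is how an l1-bound turns an entrywise error
    into an error of the quadratic form that does not see the dimension. *)
Lemma quad_max_l1 A x e : (forall i j, `|A i j| <= e) ->
  `|quad A x| <= l1norm x ^+ 2 * e.
Proof.
move=> Ae; rewrite quadE expr2 -mulrA; apply: dotp_max_l1 => i.
have -> : (A *m x) i 0 = dotp x ((row i A)^T).
  by rewrite mxE; apply: eq_bigr => j _; rewrite !mxE mulrC.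
by apply: dotp_max_l1 => j; rewrite !mxE.
Qed.

Lemma dotp_le_l1 x : dotp x x <= l1norm x ^+ 2.
Proof.
rewrite expr2 -[leLHS]ger0_norm ?dotp_ge0//; apply: dotp_max_l1 => i.
by rewrite /l1norm (bigD1 i)//= lerDl sumr_ge0.
Qed.

Definition orthonormal (v : 'I_r -> 'cV[R]_r) :=
  forall i j, dotp (v i) (v j) = (i == j)%:R.

Section Orthonormal.
Variable v : 'I_r -> 'cV[R]_r.
Hypothesis ov : orthonormal v.

(** A square matrix [V] with orthonormal columns has [V^T] as a two-sided inverse, so
    [x = V (V^T x)]. *)
Lemma orthonormal_expand x : x = \sum_i dotp (v i) x *: v i.
Proof.
pose V : 'M[R]_r := \matrix_(i, j) v j i 0.
have VV : V^T *m V = 1%:M.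
  apply/matrixP => i j; rewrite !mxE -ov; apply: eq_bigr => k _.
  by rewrite !mxE.
rewrite -[LHS]mul1mx -(mulmx1C VV) -mulmxA.
apply/matrixP => i j; rewrite ord1 !mxE summxE; apply: eq_bigr => k _.
rewrite !mxE mulrC; congr (_ * _).
by apply: eq_bigr => l _; rewrite !mxE.
Qed.

Lemma dotp_suml (I : finType) (Q : pred I) (F : I -> 'cV[R]_r) y :
  dotp (\sum_(i | Q i) F i) y = \sum_(i | Q i) dotp (F i) y.
Proof.
apply: (big_morph (fun z => dotp z y)) => [a b|]; first exact: dotpDl.
by rewrite /dotp big1 // => i _; rewrite mxE mul0r.
Qed.

Lemma parseval x y : dotp x y = \sum_i dotp (v i) x * dotp (v i) y.
Proof.
rewrite {1}(orthonormal_expand x) dotp_suml.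
by apply: eq_bigr => i _; rewrite dotpZl.
Qed.

Lemma parseval_sqr x : dotp x x = \sum_i dotp (v i) x ^+ 2.
Proof. by rewrite parseval; apply: eq_bigr => i _; rewrite expr2. Qed.

Lemma bessel2 i j x : i != j -> dotp (v i) x ^+ 2 + dotp (v j) x ^+ 2 <= dotp x x.
Proof.
move=> ij; rewrite parseval_sqr (bigD1 i)//= (bigD1 j) 1?eq_sym//= addrA lerDl.
by apply: sumr_ge0 => k _; rewrite sqr_ge0.
Qed.

Lemma quad_spectral A (lam : 'I_r -> R) x : A^T = A ->
  (forall j, A *m v j = lam j *: v j) ->
  quad A x = \sum_i lam i * dotp (v i) x ^+ 2.
Proof.
move=> sA Av; rewrite quadE parseval; apply: eq_bigr => i _.
rewrite (dotpC _ (A *m x)) dotp_mulmxl sA Av dotpZr (dotpC x) expr2; ring.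
Qed.

End Orthonormal.

End InnerProduct.

Lemma eigensystem_orthonormal (R : realType) r (M : 'M[R]_r) lam v :
  eigensystem M lam v -> orthonormal v.
Proof. by move=> [_ ov _] i j; rewrite dotpE ov. Qed.

(** * Chains of deflations *)

Lemma sqr_le_norm (R : realDomainType) (a s : R) :
  0 <= s -> a ^+ 2 <= s ^+ 2 -> `|a| <= s.
Proof. by move=> s0; rewrite -(real_normK (num_real a)) ler_sqr ?nnegrE. Qed.

Section Deflation.
Variables (R : realType) (r : nat).
Implicit Types (x y z q : 'cV[R]_r) (vh : nat -> 'cV[R]_r).

Definition deflate q x := x - dotp q x *: q.

(** The conjugations in [deflated] are nested, so a vector meets the most recent [vh] first and
    [vh 0] last. *)
Fixpoint deflate_chain vh k x :=
  if k is k'.+1 then deflate_chain vh k' (deflate (vh k') x) else x.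

Lemma deflateE q x : (1%:M - q *m q^T) *m x = deflate q x.
Proof.
rewrite mulmxBl mul1mx -mulmxA /deflate; congr (_ - _).
by rewrite [q^T *m x]mx11_scalar -dotpE mul_mx_scalar.
Qed.

Lemma quad_deflated A vh k x :
  quad (deflated A vh k) x = quad A (deflate_chain vh k x).
Proof.
elim: k x => [//|k IH] x /=; rewrite -IH -deflateE /quad trmx_mul.
have -> : (1%:M - vh k *m (vh k)^T)^T = 1%:M - vh k *m (vh k)^T.
  by rewrite raddfB /= tr_scalar_mx trmx_mul trmxK.
by rewrite !mulmxA.
Qed.

(** PMD vectors are only constrained to norm at most 1, so a deflation need not be a projection.
    With [c = <q, x>] the squared norm drops by [c^2 (2 - |q|^2)], which is still at least [c^2]. *)
Lemma deflate_dotp q x : dotp q q <= 1 ->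
  dotp (deflate q x) (deflate q x) <= dotp x x - dotp q x ^+ 2.
Proof.
move=> q1; rewrite /deflate dotpBl !dotpBr !dotpZl !dotpZr (dotpC x q).
by rewrite -subr_ge0; have := sqr_ge0 (dotp q x); nra.
Qed.

Lemma deflate_le q x : dotp q q <= 1 ->
  dotp (deflate q x) (deflate q x) <= dotp x x.
Proof. by move=> q1; apply: le_trans (deflate_dotp x q1) _; rewrite gerBl sqr_ge0. Qed.

Lemma deflate_adj q x z : dotp (deflate q x) z = dotp x (deflate q z).
Proof. by rewrite /deflate dotpBl dotpBr dotpZl dotpZr (dotpC x q); ring. Qed.

Lemma dotp_norm_le1 x y : dotp x x <= 1 -> dotp y y <= 1 -> `|dotp x y| <= 1.
Proof.
move=> x1 y1; apply: sqr_le_norm => //; rewrite expr1n.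
apply: le_trans (dotp_CS _ _) _.
by rewrite -(mulr1 1); apply: ler_pM; rewrite ?dotp_ge0.
Qed.

Lemma chain_le vh k x : (forall i, (i < k)%N -> dotp (vh i) (vh i) <= 1) ->
  dotp (deflate_chain vh k x) (deflate_chain vh k x) <= dotp x x.
Proof.
elim: k x => [//|j IH] x v1 /=.
apply: le_trans (deflate_le x (v1 j _)) => //; apply: IH => i ij.
exact/v1/ltnW.
Qed.

(** Each deflation subtracts a vector of l1-norm at most [tau] with a coefficient of modulus at most
    1. *)
Lemma chain_l1 vh k tau x : (forall i, (i < k)%N -> dotp (vh i) (vh i) <= 1) ->
  (forall i, (i < k)%N -> l1norm (vh i) <= tau) ->
  dotp x x <= 1 -> l1norm (deflate_chain vh k x) <= l1norm x + k%:R * tau.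
Proof.
elim: k x => [|j IH] x v1 vt x1 /=; first by rewrite mul0r addr0.
have q1 := v1 j (ltnSn j).
have dx1 := le_trans (deflate_le x q1) x1.
apply: le_trans (IH _ _ _ dx1) _ => [i ij|i ij|]; [exact/v1/ltnW|exact/vt/ltnW|].
have : l1norm (deflate (vh j) x) <= l1norm x + tau.
  apply: le_trans (l1normD _ _) _; rewrite lerD2l -scaleNr l1normZ normrN.
  apply: le_trans (vt j (ltnSn j)); rewrite ler_piMl ?l1norm_ge0//.
  exact: dotp_norm_le1.
by rewrite -natr1 mulrDl mul1r; lra.
Qed.

(* The drift of the component along [v] is controlled by the product of the two
   small quantities [s] and [g]; this second-order bound is what keeps the
   eigenvector error linear in the sampling error. *)
Lemma chain_drift vh k v s g x : 0 <= s -> 0 <= g ->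
  (forall i, (i < k)%N -> dotp (vh i) (vh i) <= 1) ->
  (forall i, (i < k)%N -> `|dotp (vh i) v| <= s) ->
  dotp x x - dotp (deflate_chain vh k x) (deflate_chain vh k x) <= g ^+ 2 ->
  `|dotp (deflate_chain vh k x) v - dotp x v| <= k%:R * s * g.
Proof.
move=> s0 g0; elim: k x => [|j IH] x v1 vs /= xg.
  by rewrite subrr normr0 !mul0r.
have q1 := v1 j (ltnSn j).
have v1' i : (i < j)%N -> dotp (vh i) (vh i) <= 1 by move=> ij; exact/v1/ltnW.
have H1 := deflate_dotp x q1.
have H2 := chain_le (deflate (vh j) x) v1'.
have sq := sqr_ge0 (dotp (vh j) x).
have vg : `|dotp (vh j) x| <= g by apply: sqr_le_norm => //; lra.
have H3 : `|dotp (deflate_chain vh j (deflate (vh j) x)) v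
            - dotp (deflate (vh j) x) v| <= j%:R * s * g.
  by apply: IH => // [i ij|]; [exact/vs/ltnW|lra].
rewrite -(subrK (dotp (deflate (vh j) x) v) (dotp (deflate_chain _ _ _) _)).
rewrite -addrA; apply: le_trans (ler_normD _ _) _.
rewrite -natr1 2!mulrDl mul1r; apply: lerD => //.
rewrite /deflate dotpBl addrC addKr normrN dotpZl normrM (mulrC s).
by apply: ler_pM => //; exact: vs.
Qed.

Lemma chain_norm_drift vh k v s x : 0 <= s ->
  (forall i, (i < k)%N -> dotp (vh i) (vh i) <= 1) ->
  (forall i, (i < k)%N -> `|dotp (vh i) v| <= s) -> dotp x x <= 1 ->
  `|dotp (deflate_chain vh k x) v - dotp x v| <= k%:R * s.
Proof.
move=> s0 v1 vs x1; rewrite -[leRHS]mulr1; apply: chain_drift => //.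
by rewrite expr1n lerBlDr; apply: le_trans x1 _; rewrite lerDl dotp_ge0.
Qed.

(** Deflation is symmetric, so after the step with [vh j] the component on [v] is that of the input
    on the small vector [deflate (vh j) v]. Each of the remaining steps can restore at most [s]. *)
Lemma chain_kill vh k j v s x : 0 <= s -> (j < k)%N ->
  (forall i, (i < k)%N -> dotp (vh i) (vh i) <= 1) ->
  (forall i, (i < k)%N -> i != j -> `|dotp (vh i) v| <= s) ->
  dotp (deflate (vh j) v) (deflate (vh j) v) <= s ^+ 2 -> dotp x x <= 1 ->
  `|dotp (deflate_chain vh k x) v| <= k%:R * s.
Proof.
move=> s0; elim: k x => [//|k IH] x jk v1 vs dv x1 /=.
have q1 := v1 k (ltnSn k).
have v1' i : (i < k)%N -> dotp (vh i) (vh i) <= 1 by move=> ij; exact/v1/ltnW.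
have y1 := le_trans (deflate_le x q1) x1.
have [jk'|kj] := ltnP j k.
  apply: le_trans (IH _ jk' v1' _ dv y1) _ => [i ik|]; first exact/vs/ltnW.
  by rewrite ler_wpM2r// ler_nat.
have {kj} jE : k = j by apply/eqP; rewrite eqn_leq kj -ltnS jk.
have D : `|dotp (deflate_chain vh k (deflate (vh k) x)) v
    - dotp (deflate (vh k) x) v| <= k%:R * s.
  by apply: chain_norm_drift => // i ik; apply: vs; [exact: ltnW|rewrite -jE ltn_eqF].
rewrite -(subrK (dotp (deflate (vh k) x) v) (dotp (deflate_chain _ _ _) _)).
apply: le_trans (ler_normD _ _) _; rewrite -natr1 mulrDl mul1r; apply: lerD => //.
rewrite deflate_adj jE; apply: sqr_le_norm => //; apply: le_trans dv.
by apply: le_trans (dotp_CS _ _) _; rewrite ler_piMl ?dotp_ge0.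
Qed.

(* Bootstrap: the crude loss [x] feeds back through [chain_drift] as
   [x <= k s sqrt (2 x)]. *)
Lemma chain_keep vh k v s : 0 <= s ->
  (forall i, (i < k)%N -> dotp (vh i) (vh i) <= 1) ->
  (forall i, (i < k)%N -> `|dotp (vh i) v| <= s) -> dotp v v = 1 ->
  1 - dotp (deflate_chain vh k v) v <= 2 * k%:R ^+ 2 * s ^+ 2.
Proof.
move=> s0 v1 vs vv; set z := deflate_chain vh k v; set x := 1 - _.
have zz : dotp z z <= 1 by rewrite -vv; exact: chain_le.
have zv1 : `|dotp z v| <= 1 by apply: dotp_norm_le1; rewrite ?vv.
have x0 : 0 <= x by rewrite subr_ge0; move: zv1; rewrite ler_norml => /andP[].
have CS := dotp_CS z v; rewrite vv mulr1 in CS.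
have g2 : dotp v v - dotp z z <= Num.sqrt (2 * x) ^+ 2.
  rewrite sqr_sqrtr ?mulr_ge0// vv.
  have zvE : dotp z v = 1 - x by rewrite /x opprB addrCA subrr addr0.
  by rewrite zvE in CS; have := sqr_ge0 x; nra.
have := chain_drift s0 (sqrtr_ge0 _) v1 vs g2.
rewrite vv -/z distrC -/x ger0_norm// => H.
have : x ^+ 2 <= k%:R ^+ 2 * s ^+ 2 * (2 * x).
  rewrite -[in leRHS](@sqr_sqrtr _ (2 * x)) ?mulr_ge0// -!exprMn.
  by rewrite ler_sqr// nnegrE (le_trans x0 H).
have [->|xn0] := eqVneq x 0; first by rewrite !mulr_ge0 ?sqr_ge0.
rewrite expr2 mulrA ler_pM2r; last by rewrite lt_def xn0.
by rewrite (mulrC _ 2) mulrA.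
Qed.

End Deflation.

(** * Perturbation of the PMD vectors *)

Section PMDPerturbation.
Variables (R : realType) (r d : nat) (M A : 'M[R]_r).
Variables (lam : 'I_r -> R) (v : 'I_r -> 'cV[R]_r) (vh : nat -> 'cV[R]_r).
Variables (L delta tau e : R).
Hypothesis eig : eigensystem M lam v.
Hypothesis sM : M^T = M.
Hypothesis lam_ge0 : forall i, 0 <= lam i.
Hypothesis lam_le : forall i, lam i <= L.
Hypothesis delta_gt0 : 0 < delta.
Hypothesis gap : forall i j : 'I_r,
  (i < d)%N -> j = i.+1 :> nat -> delta <= lam i - lam j.
Hypothesis d_lt_r : (d < r)%N.
Hypothesis v_l1 : forall j : 'I_r, (j < d)%N -> l1norm (v j) <= tau.
Hypothesis A_M : forall i j, `|A i j - M i j| <= e.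
Hypothesis pmd : PMD d tau A vh.

Let ov : orthonormal v := eigensystem_orthonormal eig.
Let eta := tau ^+ 2 * e.

Let vv j : dotp (v j) (v j) = 1. Proof. by rewrite ov eqxx. Qed.

Lemma PMD_norm_le1 k : (k < d)%N -> dotp (vh k) (vh k) <= 1.
Proof. by move=> kd; rewrite -l2norm_sqr; have [[]] := pmd kd. Qed.

Lemma PMD_l1 k : (k < d)%N -> l1norm (vh k) <= tau.
Proof. by move=> kd; have [[]] := pmd kd. Qed.

(** In the spectral sum, each index before [k] contributes at most [L * b], and every index after
    [k] has eigenvalue at most [lam k1]. Replacing all these eigenvalues by [lam k1] leaves the
    excess [lam k - lam k1] on the component along [v k]. *)
Lemma quad_top (k k1 : 'I_r) (b : R) w : k1 = k.+1 :> nat -> 0 <= b ->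
  (forall j : 'I_r, (j < k)%N -> dotp (v j) w ^+ 2 <= b) -> dotp w w <= 1 ->
  quad M w <=
    lam k - (lam k - lam k1) * (1 - dotp (v k) w ^+ 2) + k%:R * (L * b).
Proof.
move=> k1E b0 wb w1; have [lamD _ Mv] := eig.
have L0 : 0 <= L := le_trans (lam_ge0 k) (lam_le k).
rewrite (quad_spectral ov w sM Mv).
have : \sum_i lam i * dotp (v i) w ^+ 2 <= \sum_i (lam k1 * dotp (v i) w ^+ 2
    + (if i == k then (lam k - lam k1) * dotp (v k) w ^+ 2 else 0)
    + (if (i < k)%N then L * b else 0)).
  apply: ler_sum => i _; have sq := sqr_ge0 (dotp (v i) w).
  case: (ltngtP i k) => [ik|ik|/val_inj->].
  - rewrite -(inj_eq val_inj) /= (ltn_eqF ik) addr0.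
    apply: le_trans (_ : L * b <= _); first by apply: ler_pM => //; exact: wb.
    by rewrite lerDr mulr_ge0.
  - rewrite -(inj_eq val_inj) /= (gtn_eqF ik) !addr0 ler_wpM2r// lamD//.
    by rewrite k1E.
  - by rewrite eqxx addr0 -mulrDl addrC subrK.
rewrite !big_split /= -big_mkcond/= big_pred1_eq -mulr_sumr -parseval_sqr//.
rewrite -big_mkcond /= -(@big_ord_widen _ _ _ k r (fun=> L * b)); last exact/ltnW.
rewrite sumr_const card_ord -(mulr_natl (L * b)) => H; apply: le_trans H _.
rewrite lerD2r; have := lam_ge0 k1.
have : lam k1 * dotp w w <= lam k1 by rewrite ler_piMr.
lra.
Qed.

Lemma quad_bottom (k : 'I_r) w : lam k * dotp (v k) w ^+ 2 <= quad M w.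
Proof.
have [_ _ Mv] := eig; rewrite (quad_spectral ov w sM Mv) (bigD1 k)//= lerDl.
by apply: sumr_ge0 => i _; rewrite mulr_ge0 ?sqr_ge0.
Qed.

Lemma quad_perturb w t : l1norm w <= t -> `|quad A w - quad M w| <= t ^+ 2 * e.
Proof.
move=> wt; rewrite -quad_sub.
have r0 : (0 < r)%N by exact: leq_ltn_trans d_lt_r.
have e0 : 0 <= e := le_trans (normr_ge0 _) (A_M (Ordinal r0) (Ordinal r0)).
apply: le_trans (_ : l1norm w ^+ 2 * e <= _).
  by apply: quad_max_l1 => i j; rewrite !mxE.
by rewrite ler_wpM2r// ler_sqr ?nnegrE ?l1norm_ge0// (le_trans (l1norm_ge0 w)).
Qed.

(** Bessel's inequality: [vh i] has norm at most 1, so what it has on [v j] is taken from what it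
    lacks on [v i]. *)
Lemma score_loss_other (i j : 'I_r) s : 0 <= s -> (i < d)%N ->
  1 - dotp (vh i) (v i) ^+ 2 <= s ^+ 2 -> i != j -> `|dotp (vh i) (v j)| <= s.
Proof.
move=> s0 id H ij; apply: sqr_le_norm => //.
have := bessel2 ov (vh i) ij; rewrite !(dotpC (v _)).
by have := PMD_norm_le1 id; lra.
Qed.

(** The chains [z] from [v k] and [w] from [vh k] are compared through the optimality of [vh k].
    Spectral bounds for [M] at [z] and [w] control the component of [w] on [v k], and [chain_drift]
    carries this control back to [vh k]. *)
Lemma PMD_step (k : 'I_r) s : (k < d)%N -> 0 <= s ->
  (forall j : 'I_r, (j < k)%N -> 1 - dotp (vh j) (v j) ^+ 2 <= s ^+ 2) ->
  1 - dotp (vh k) (v k) ^+ 2 <=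
    2 * ((L * (k%:R ^+ 3 + 4 * k%:R ^+ 2) * s ^+ 2
          + 2 * (k%:R + 1) ^+ 2 * eta) / delta) + k%:R ^+ 2 * s ^+ 2.
Proof.
move=> kd s0 IH.
have ltd i : (i < k)%N -> (i < d)%N by move=> ik; exact: ltn_trans kd.
have ltr i : (i < k)%N -> (i < r)%N by move=> ik; exact: ltn_trans (ltn_ord k).
have vh1 i : (i < k)%N -> dotp (vh i) (vh i) <= 1 by move/ltd/PMD_norm_le1.
have vht i : (i < k)%N -> l1norm (vh i) <= tau by move/ltd/PMD_l1.
have vhk1 := PMD_norm_le1 kd.
have off (j : 'I_r) i : (i < k)%N -> i != j -> `|dotp (vh i) (v j)| <= s.
  move=> ik ij; pose i' := Ordinal (ltr i ik).
  by apply: (@score_loss_other i') => //; [exact: ltd|exact: (IH i')].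
have offk i : (i < k)%N -> `|dotp (vh i) (v k)| <= s.
  by move=> ik; apply: off => //; rewrite ltn_eqF.
set z := deflate_chain vh k (v k).
set w := deflate_chain vh k (vh k).
have w1 : dotp w w <= 1 by apply: le_trans vhk1; exact: chain_le.
have z1 : dotp z z <= 1 by rewrite -(vv k); exact: chain_le.
have L0 : 0 <= L := le_trans (lam_ge0 k) (lam_le k).
have l1z : l1norm z <= (k%:R + 1) * tau.
  apply: le_trans (chain_l1 vh1 vht _) _; rewrite ?vv//.
  by rewrite mulrDl mul1r addrC lerD2l v_l1.
have l1w : l1norm w <= (k%:R + 1) * tau.
  apply: le_trans (chain_l1 vh1 vht vhk1) _.
  by rewrite mulrDl mul1r addrC lerD2l; exact: PMD_l1.
(* [v k] competes in the k-th PMD problem since its l1-norm is at most [tau]; [quad_deflated]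
   rewrites both values as forms of [A] at the ends of the chains. *)
have opt : quad A z <= quad A w.
  have [_] := pmd kd; move=> /(_ (v k)); rewrite !quad_deflated; apply.
  by split; [exact: v_l1|rewrite l2norm_sqr vv].
have Pz := quad_perturb l1z; have Pw := quad_perturb l1w.
rewrite exprMn -mulrA -/eta in Pz Pw.
have keep : 1 - dotp (v k) z ^+ 2 <= 4 * k%:R ^+ 2 * s ^+ 2.
  have := chain_keep s0 vh1 offk (vv k); rewrite -/z (dotpC z).
  have : `|dotp (v k) z| <= 1 by apply: dotp_norm_le1; rewrite ?vv.
  rewrite ler_norml => /andP[_ zle].
  have := sqr_ge0 (1 - dotp (v k) z); nra.
have zlow : lam k - 4 * L * k%:R ^+ 2 * s ^+ 2 <= quad M z.
  apply: le_trans (quad_bottom k z).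
  have K0 : 0 <= 4 * k%:R ^+ 2 * s ^+ 2 :> R by rewrite !mulr_ge0 ?sqr_ge0.
  have := ler_wpM2l (lam_ge0 k) keep.
  have := ler_wpM2r K0 (lam_le k).
  lra.
have kr : (k.+1 < r)%N by apply: leq_ltn_trans d_lt_r.
pose k1 := Ordinal kr.
(* Directions found earlier are almost absent from [w]: deflating [v j] by [vh j] leaves a squared
   norm of at most [1 - <vh j, v j>^2]. *)
have wj (j : 'I_r) : (j < k)%N -> dotp (v j) w ^+ 2 <= k%:R ^+ 2 * s ^+ 2.
  move=> jk; rewrite -exprMn -(real_normK (num_real (dotp _ _))).
  rewrite ler_sqr ?nnegrE ?mulr_ge0// dotpC.
  apply: (@chain_kill _ _ vh k j (v j) s) => // [i ik ij|]; first exact: off.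
  apply: le_trans (IH j jk); apply: le_trans (deflate_dotp _ (vh1 j jk)) _.
  by rewrite vv.
have wtop := @quad_top k k1 _ w erefl (mulr_ge0 (sqr_ge0 _) (sqr_ge0 _)) wj w1.
have a1 : dotp (v k) w ^+ 2 <= 1.
  by apply: le_trans (dotp_CS _ _) _; rewrite vv mul1r.
have gapk : delta <= lam k - lam k1 by exact: gap.
(* Optimality and two perturbations give [quad M z <= quad M w + 2 (k + 1)^2 eta]. Inserting [zlow]
   and [wtop] bounds the spectral gap times the loss of [w] by the numerator of [B]. *)
set B := _ / delta.
have a1B : 1 - dotp w (v k) ^+ 2 <= B.
  rewrite dotpC ler_pdivlMr// mulrC.
  apply: le_trans (_ : (lam k - lam k1) * (1 - dotp (v k) w ^+ 2) <= _).
    by rewrite ler_wpM2r// subr_ge0.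
  move: Pz Pw; rewrite !ler_norml => /andP[Pz _] /andP[_ Pw].
  by move: wtop zlow Pz Pw opt; set x := (lam k - _) * _; lra.
have B0 : 0 <= B by apply: le_trans a1B; rewrite subr_ge0 dotpC.
(* Since [|w|^2 >= <w, v k>^2], the squared norm lost between [vh k] and [w] is also at most [B],
   which allows [g = sqrt B]. *)
have drift : `|dotp w (v k) - dotp (vh k) (v k)| <= k%:R * s * Num.sqrt B.
  apply: chain_drift => //; rewrite sqr_sqrtr//; apply: le_trans a1B.
  apply: lerB => //; apply: le_trans (dotp_CS _ _) _.
  by rewrite vv mulr1.
have na : `|dotp w (v k)| <= 1 by apply: dotp_norm_le1; rewrite ?vv.
have nc : `|dotp (vh k) (v k)| <= 1 by apply: dotp_norm_le1; rewrite ?vv.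
have -> : 1 - dotp (vh k) (v k) ^+ 2 = (1 - dotp w (v k) ^+ 2)
  + (dotp w (v k) - dotp (vh k) (v k)) * (dotp w (v k) + dotp (vh k) (v k)).
  by ring.
have : (dotp w (v k) - dotp (vh k) (v k)) * (dotp w (v k) + dotp (vh k) (v k))
    <= k%:R * s * Num.sqrt B * 2.
  apply: le_trans (ler_norm _) _; rewrite normrM; apply: ler_pM => //.
  by apply: le_trans (ler_normD _ _) _; lra.
have sB := sqr_sqrtr B0.
(* [2 k s sqrt B <= k^2 s^2 + B]: this doubles [B] and produces the last term of the bound. *)
have := sqr_ge0 (k%:R * s - Num.sqrt B).
move: a1B; move: (Num.sqrt B) sB => q <-; nra.
Qed.

End PMDPerturbation.

(* Any value of the recursion that dominates [PMD_step] will do; it only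
   matters that it depends on neither the dimension nor the error. *)
Fixpoint PMD_const (R : realType) (L delta : R) k : R :=
  if k is k'.+1 then
    let C := PMD_const L delta k' in
    C + (2 * ((L * (k'%:R ^+ 3 + 4 * k'%:R ^+ 2) * C
               + 2 * (k'%:R + 1) ^+ 2) / delta) + k'%:R ^+ 2 * C)
  else 0.

Lemma PMD_const_ge0 (R : realType) (L delta : R) k :
  0 <= L -> 0 < delta -> 0 <= PMD_const L delta k.
Proof.
move=> L0 d0; elim: k => [//|k IH] /=; have := ltW d0 => ?.
by rewrite !(addr_ge0, mulr_ge0, sqr_ge0, exprn_ge0, invr_ge0).
Qed.

Lemma PMD_eigenvectors (R : realType) (r d : nat) (M A : 'M[R]_r) lam v vh
    (L delta tau e : R) :
  eigensystem M lam v -> M^T = M -> (forall i, 0 <= lam i) ->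
  (forall i, lam i <= L) -> 0 < delta ->
  (forall i j : 'I_r, (i < d)%N -> j = i.+1 :> nat -> delta <= lam i - lam j) ->
  (d < r)%N -> (forall j : 'I_r, (j < d)%N -> l1norm (v j) <= tau) ->
  (forall i j, `|A i j - M i j| <= e) -> PMD d tau A vh ->
  forall j : 'I_r, (j < d)%N ->
  1 - dotp (vh j) (v j) ^+ 2 <= PMD_const L delta d * (tau ^+ 2 * e).
Proof.
move=> eig sM lam0 lamL d0 gap dr vt AM pmd.
have r0 : (0 < r)%N by exact: leq_ltn_trans dr.
have e0 : 0 <= e by exact: le_trans (normr_ge0 _) (AM (Ordinal r0) (Ordinal r0)).
have L0 : 0 <= L := le_trans (lam0 (Ordinal r0)) (lamL _).
have eta0 : 0 <= tau ^+ 2 * e by rewrite mulr_ge0 ?sqr_ge0.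
suff H k : (k <= d)%N -> forall j : 'I_r, (j < k)%N ->
    1 - dotp (vh j) (v j) ^+ 2 <= PMD_const L delta k * (tau ^+ 2 * e).
  exact: H.
elim: k => [//|k IH] kd j; rewrite ltnS leq_eqVlt.
set C := PMD_const L delta k; have C0 : 0 <= C by exact: PMD_const_ge0.
have Ce0 : 0 <= C * (tau ^+ 2 * e) by rewrite mulr_ge0.
have d0' := ltW d0.
move=> /predU1P[jk|jk]; last first.
  apply: le_trans (IH (ltnW kd) _ jk) _; rewrite ler_wpM2r//= -/C lerDl.
  by rewrite !(addr_ge0, mulr_ge0, sqr_ge0, exprn_ge0, invr_ge0).
(* [s ^+ 2] is the bound already shared by all earlier vectors. The estimate is linear in [s ^+ 2]
   and in the sampling error, so the factor [tau ^+ 2 * e] comes out. *)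
apply: le_trans (PMD_step eig sM lam0 lamL d0 gap dr vt AM pmd _
  (sqrtr_ge0 (C * (tau ^+ 2 * e))) _) _.
- by rewrite jk.
- by move=> i ij; rewrite sqr_sqrtr//; apply: IH (ltnW kd) _ _; rewrite -jk.
rewrite sqr_sqrtr//= -/C -jk.
have -> : forall a b c x : R, 2 * ((a * (C * x) + b * x) / delta) + c * (C * x)
   = (2 * ((a * C + b) / delta) + c * C) * x by move=> *; ring.
by rewrite ler_wpM2r// lerDr.
Qed.

(** * Orthogonal projectors and the envelope *)

Section OrthogonalProjector.
Variables (R : realType) (r : nat).
Implicit Types S A : 'M[R]_r.

Lemma capmx_kermx_tr S : (S :&: kermx S^T)%MS = 0.
Proof.
apply/eqP/rowV0P => x; rewrite sub_capmx => /andP[/submxP[y xE] /sub_kermxP xK].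
suff /dotp_eq0/(congr1 trmx) : dotp x^T x^T = 0 by rewrite trmxK trmx0.
rewrite dotpE trmxK {2}xE trmx_mul mulmxA xK.
by rewrite mul0mx mxE.
Qed.

Lemma addsmx_kermx_tr S m (W : 'M[R]_(m, r)) : (W <= S + kermx S^T)%MS.
Proof.
apply: submx_full; rewrite /row_full mxrank_disjoint_sum; last exact: capmx_kermx_tr.
by rewrite mxrank_ker mxrank_tr subnKC// rank_leq_row.
Qed.

Lemma orthproj_sub S m (W : 'M[R]_(m, r)) : (W *m orthproj S <= S)%MS.
Proof. exact: proj_mx_sub. Qed.

Lemma orthproj_id S m (W : 'M[R]_(m, r)) : (W <= S)%MS -> W *m orthproj S = W.
Proof. by move=> WS; rewrite /orthproj proj_mx_id// capmx_kermx_tr. Qed.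

Lemma orthproj_idem S : orthproj S *m orthproj S = orthproj S.
Proof. by apply: orthproj_id; rewrite -[X in (X <= _)%MS]mul1mx orthproj_sub. Qed.

(** The rows of [Q] lie in [S] and those of [1 - Q] in the kernel of [S^T]. Hence [(1 - Q) Q^T = 0],
    and [Q^T = Q Q^T] is symmetric. *)
Lemma orthproj_tr S : (orthproj S)^T = orthproj S.
Proof.
set Q := orthproj S.
have QS : (Q <= S)%MS by rewrite -[X in (X <= _)%MS]mul1mx orthproj_sub.
have /sub_kermxP K : (1%:M - Q <= kermx S^T)%MS.
  by rewrite -[X in _ - X]mul1mx; apply: proj_mx_compl_sub; exact: addsmx_kermx_tr.
have QE : Q^T = Q *m Q^T.
  apply/eqP; rewrite -subr_eq0 -[X in X - _]mul1mx -mulmxBl.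
  by case/submxP: QS => D /(congr1 trmx)->; rewrite trmx_mul mulmxA K mul0mx.
have := congr1 trmx QE; rewrite trmxK trmx_mul trmxK => QE2.
by rewrite QE -QE2.
Qed.

Lemma orthproj_col S (x : 'cV[R]_r) : (x^T <= S)%MS -> orthproj S *m x = x.
Proof.
move=> /orthproj_id/(congr1 trmx).
by rewrite trmx_mul trmxK orthproj_tr.
Qed.

Lemma orthproj_col0 S (x : 'cV[R]_r) : S *m x = 0 -> orthproj S *m x = 0.
Proof.
move=> Sx; suff : x^T *m orthproj S = 0.
  by move/(congr1 trmx); rewrite trmx_mul trmxK orthproj_tr trmx0.
apply: proj_mx_0; first exact: capmx_kermx_tr.
by apply/sub_kermxP; rewrite -trmx_mul Sx trmx0.
Qed.

Lemma orthproj_sub_col S (x : 'cV[R]_r) : orthproj S *m x = x -> (x^T <= S)%MS.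
Proof.
by move/(congr1 trmx); rewrite trmx_mul orthproj_tr => <-; exact: orthproj_sub.
Qed.

(** In a full-rank factorization of an idempotent, the product of the two factors in reverse order
    is the identity of size the rank. *)
Lemma mxtrace_idem A : A *m A = A -> \tr A = (\rank A)%:R.
Proof.
move=> AA; rewrite -{1}(mulmx_base A) mxtrace_mulC.
suff -> : row_base A *m col_base A = 1%:M by rewrite mxtrace1.
apply: (row_free_inj (row_base_free A)); rewrite mul1mx.
apply: (@row_full_inj _ _ _ _ (col_base A)); first exact: col_base_full.
by rewrite -mulmxA mulmx_base mulmxA mulmx_base.
Qed.

Lemma mxtrace_orthproj S : \tr (orthproj S) = (\rank S)%:R.
Proof.
rewrite mxtrace_idem ?orthproj_idem//; congr _%:R; apply/eqP.
rewrite eqn_leq; apply/andP; split; apply: mxrankS.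
  by rewrite -[X in (X <= _)%MS]mul1mx orthproj_sub.
by rewrite -[X in (X <= _)%MS](orthproj_id (submx_refl S)) submxMl.
Qed.

(** The left side is the squared distance from [x] to [S], hence at most the distance to any [y] in
    [S]. *)
Lemma quad_orthproj S x y : (y^T <= S)%MS ->
  dotp x x - quad (orthproj S) x <= dotp (x - y) (x - y).
Proof.
move=> /orthproj_col yS; set Q := orthproj S in yS *.
have sQ : Q^T = Q := orthproj_tr S.
have xQQ : quad Q x = dotp (Q *m x) (Q *m x).
  by rewrite quadE (dotp_mulmxl Q x) sQ mulmxA orthproj_idem.
have xQy : dotp x y = dotp (Q *m x) y by rewrite dotp_mulmxl sQ yS.
have := dotp_ge0 (Q *m x - y).
rewrite !dotpBl !dotpBr (dotpC y x) (dotpC y (Q *m x)) xQQ xQy; lra.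
Qed.

Lemma frobenius_sqr A : frobenius A ^+ 2 = \tr (A *m A^T).
Proof.
rewrite sqr_sqrtr; last first.
  by apply: sumr_ge0 => i _; apply: sumr_ge0 => j _; rewrite sqr_ge0.
apply: eq_bigr => i _; rewrite mxE; apply: eq_bigr => j _.
by rewrite mxE expr2.
Qed.

(** * Traces, ranks and projectors in an orthonormal basis *)

Section InOrthonormalBasis.
Variable v : 'I_r -> 'cV[R]_r.
Hypothesis ov : orthonormal v.

Lemma orthonormal_sum : \sum_i v i *m (v i)^T = 1%:M.
Proof.
apply/trmx_inj/row_matrixP => i; rewrite -!tr_col; congr trmx.
rewrite colE mulmx_suml [RHS]colE mul1mx [RHS](orthonormal_expand ov).
apply: eq_bigr => j _; rewrite -mulmxA [(v j)^T *m _]mx11_scalar -dotpE.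
by rewrite mul_mx_scalar.
Qed.

Lemma orthonormal_ext m (A B : 'M[R]_(m, r)) :
  (forall i, A *m v i = B *m v i) -> A = B.
Proof.
move=> AB; rewrite -[A]mulmx1 -[B]mulmx1 -orthonormal_sum !mulmx_sumr.
by apply: eq_bigr => i _; rewrite !mulmxA AB.
Qed.

Lemma mxtrace_orthonormal A : \tr A = \sum_i quad A (v i).
Proof.
rewrite -{1}[A]mulmx1 -orthonormal_sum mulmx_sumr raddf_sum /=.
by apply: eq_bigr => i _; rewrite mulmxA mxtrace_mulC mulmxA /mxtrace big_ord1.
Qed.

Definition vspan (J : pred 'I_r) : 'M[R]_r := (\sum_(j | J j) <<(v j)^T>>)%MS.

Lemma vspan_sub (J : pred 'I_r) j : J j -> ((v j)^T <= vspan J)%MS.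
Proof. by move=> Jj; rewrite -genmxE; apply: (sumsmx_sup j). Qed.

Lemma vspan_mul0 m (W : 'M[R]_(m, r)) (J : pred 'I_r) i :
  (W <= vspan J)%MS -> ~~ J i -> W *m v i = 0.
Proof.
move=> WJ Ji; apply/sub_kermxP; apply: submx_trans WJ _.
apply/sumsmx_subP => j Jj; rewrite genmxE; apply/sub_kermxP.
apply/matrixP => a b; rewrite !ord1 -dotpE ov mxE.
by case: eqP Ji => // <-; rewrite Jj.
Qed.

Lemma orthproj_vspan (S : 'M[R]_r) (J : pred 'I_r) i : (S :=: vspan J)%MS ->
  orthproj S *m v i = (J i)%:R *: v i.
Proof.
move=> SJ; case: (boolP (J i)) => Ji; rewrite ?scale1r ?scale0r.
  by apply: orthproj_col; rewrite SJ vspan_sub.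
by apply/orthproj_col0/(vspan_mul0 _ Ji); rewrite SJ.
Qed.

Lemma mxrank_vspan (J : pred 'I_r) : \rank (vspan J) = #|J|.
Proof.
apply/eqP; rewrite -(eqr_nat R); apply/eqP.
rewrite -mxtrace_orthproj mxtrace_orthonormal.
rewrite (eq_bigr (fun i => (J i)%:R)) => [|i _].
  by rewrite -natr_sum -sum1_card [in RHS]big_mkcond.
by rewrite quadE (orthproj_vspan _ (eqmx_refl (vspan J))) dotpZr ov eqxx mulr1.
Qed.

(** The squared norm is [rank S1 + rank S2 - 2 tr (P1 P2)], and the trace of [P1 P2] in the basis
    [v] only sees the indices of [J], where [P2] fixes [v j]. *)
Lemma frobenius_orthproj (S1 S2 : 'M[R]_r) (J : pred 'I_r) :
  (S2 :=: vspan J)%MS -> (\rank S1 <= #|J|)%N ->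
  frobenius (orthproj S1 - orthproj S2) ^+ 2
    <= 2 * \sum_(j | J j) (1 - quad (orthproj S1) (v j)).
Proof.
move=> S2J rS1; rewrite frobenius_sqr raddfB /= !orthproj_tr.
rewrite mulmxBl !mulmxBr !orthproj_idem !raddfB /= (mxtrace_mulC (orthproj S2)).
rewrite !mxtrace_orthproj S2J mxrank_vspan mxtrace_orthonormal.
have -> : \sum_i quad (orthproj S1 *m orthproj S2) (v i)
    = \sum_(i | J i) quad (orthproj S1) (v i).
  rewrite [RHS]big_mkcond; apply: eq_bigr => i _; rewrite !quadE.
  rewrite -(mulmxA (orthproj S1)) (orthproj_vspan _ S2J).
  case: (J i); first by rewrite scale1r.
  by rewrite scale0r mulmx0 dotpC /dotp big1 // => k _; rewrite mxE mul0r.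
rewrite sumrB sumr_const -(ler_nat R) in rS1 *.
by set x := \sum_(_ | _) _; lra.
Qed.

End InOrthonormalBasis.

End OrthogonalProjector.

Lemma idem_block_comm (R : nzRingType) r (Q M : 'M[R]_r) : Q *m Q = Q ->
  M = Q *m M *m Q + (1%:M - Q) *m M *m (1%:M - Q) <-> Q *m M = M *m Q.
Proof.
move=> QQ; split=> [ME|QM].
  have Q0 : Q *m (1%:M - Q) = 0 by rewrite mulmxBr mulmx1 QQ subrr.
  have Q0' : (1%:M - Q) *m Q = 0 by rewrite mulmxBl mul1mx QQ subrr.
  have -> : Q *m M = Q *m M *m Q.
    by rewrite {1}ME mulmxDr !mulmxA QQ Q0 !mul0mx addr0.
  rewrite [in RHS]ME mulmxDl -[_ *m Q *m Q]mulmxA QQ.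
  by rewrite -[_ *m (1%:M - Q) *m Q]mulmxA Q0' mulmx0 addr0.
have -> : (1%:M - Q) *m M = M *m (1%:M - Q).
  by rewrite mulmxBl mulmxBr mul1mx mulmx1 QM.
rewrite QM -!mulmxA QQ -mulmxDr mulmxBr mulmx1 mulmxBl mul1mx QQ subrr subr0.
by rewrite addrC subrK mulmx1.
Qed.

(** * The envelope in an eigenbasis of [M] *)

Section Envelope.
Variables (R : realType) (r : nat) (M U : 'M[R]_r).

Lemma reducing_comm S : reducing M S <-> orthproj S *m M = M *m orthproj S.
Proof. exact/idem_block_comm/orthproj_idem. Qed.

Variables (d : nat) (lam : 'I_r -> R) (v : 'I_r -> 'cV[R]_r).
Hypothesis eig : eigensystem M lam v.
Hypothesis sM : M^T = M.
Hypothesis sU : U^T = U.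
Hypothesis U_null : forall x, quad U x = 0 -> U *m x = 0.
Hypothesis gap : forall i j : 'I_r,
  (i < d)%N -> j = i.+1 :> nat -> lam j < lam i.
Hypothesis env_sub : (envelope M U <= vspan v (fun j => (j < d)%N))%MS.

Let ov : orthonormal v := eigensystem_orthonormal eig.

(** The smaller of the two indices is below [d], and the gap just after it separates the
    eigenvalues. *)
Lemma eigenvalue_simple (i j : 'I_r) : (j < d)%N -> i != j -> lam i != lam j.
Proof.
move=> jd; rewrite -(inj_eq val_inj) /= neq_ltn => /orP[ij|ji].
  have jr : (i.+1 < r)%N by exact: leq_ltn_trans (ltn_ord j).
  have [lamD _ _] := eig.
  have : lam (Ordinal jr) < lam i by apply: gap => //; exact: ltn_trans jd.
  have := lamD (Ordinal jr) j ij; move=> h1 h2.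
  by rewrite gt_eqF// (le_lt_trans h1).
have jr : (j.+1 < r)%N by exact: leq_ltn_trans (ltn_ord i).
have [lamD _ _] := eig.
have : lam (Ordinal jr) < lam j by exact: gap.
by have := lamD (Ordinal jr) i ji; move=> h1 h2; rewrite lt_eqF// (le_lt_trans h1).
Qed.

Lemma sub_envelope S : reducing M S -> (U <= S)%MS -> (envelope M U <= S)%MS.
Proof.
move=> rS US; apply/row_subP => i.
have /sub_mxbigcap := row_sub i (envelope M U).
by apply; split=> //; rewrite sU.
Qed.

Lemma sub_envelope_score : (U <= envelope M U)%MS.
Proof.
apply/row_subP => i; apply/sub_mxbigcap => S [_ US].
by apply: submx_trans US; rewrite sU row_sub.
Qed.

(** [Q] commutes with [M] and the eigenvalue is simple, so [Q v_j = c v_j] with [c] equal to 0 or 1.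
    If [c = 0] then [U v_j = U Q v_j = 0], against the nonzero score. *)
Lemma eigenvector_in_envelope (j : 'I_r) : (j < d)%N -> quad U (v j) != 0 ->
  ((v j)^T <= envelope M U)%MS.
Proof.
move=> jd Uj; apply/sub_mxbigcap => S [/reducing_comm QM US].
set Q := orthproj S in QM; have [_ _ Mv] := eig.
set c := dotp (v j) (Q *m v j).
have Qv : Q *m v j = c *: v j.
  rewrite [LHS](orthonormal_expand ov) (bigD1 j)//= big1 ?addr0// => i ij.
  suff -> : dotp (v i) (Q *m v j) = 0 by rewrite scale0r.
  apply/eqP; have := eigenvalue_simple jd ij; rewrite -subr_eq0 => lij.
  rewrite -(mulrI_eq0 _ (mulfI lij)) mulrBl -(dotpZl (lam i)) -Mv -(dotpZr (lam j)).
  by rewrite dotp_mulmxl sM mulmxA -QM -mulmxA Mv -scalemxAr subrr.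
apply: orthproj_sub_col; rewrite -/Q Qv.
have /(congr1 (dotp (v j))) : Q *m (Q *m v j) = Q *m v j.
  by rewrite mulmxA orthproj_idem.
rewrite Qv -scalemxAr Qv !dotpZr ov eqxx !mulr1 => /eqP.
rewrite -[X in _ == X]mulr1 -subr_eq0 -mulrBr mulf_eq0 subr_eq0.
case/orP => /eqP c01; last by rewrite c01 scale1r.
case/eqP: Uj; rewrite sU in US; rewrite quadE -(orthproj_id US) -mulmxA -/Q Qv c01.
by rewrite scale0r mulmx0 dotpC /dotp big1 // => k _; rewrite mxE mul0r.
Qed.

Lemma envelopeE :
  (envelope M U :=: vspan v (fun j => (j < d)%N && (quad U (v j) != 0)))%MS.
Proof.
apply/eqmxP/andP; split; last first.
  by apply/sumsmx_subP => j /andP[jd Uj]; rewrite genmxE eigenvector_in_envelope.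
set J := fun j : 'I_r => _; have [_ _ Mv] := eig.
apply: sub_envelope.
  apply/reducing_comm/(orthonormal_ext ov) => i.
  set Q := orthproj _; have Qv : Q *m v i = (J i)%:R *: v i by exact: orthproj_vspan.
  by rewrite -(mulmxA Q) -(mulmxA M) Mv -scalemxAr Qv -scalemxAr Mv !scalerA mulrC.
(* [U] is the sum of the matrices [U v_i v_i^T]. For [i] outside [J] the term vanishes: either
   [i >= d], and [U] lies in the span of the first [d] eigenvectors, or the score is zero and
   [U_null] applies. *)
rewrite -[X in (X <= _)%MS]mulmx1 -(orthonormal_sum ov) mulmx_sumr.
apply: summx_sub => i _; have [Ji|] := boolP (J i).
  by rewrite mulmxA; apply: submx_trans (submxMl _ _) (vspan_sub v Ji).
rewrite negb_and negbK => Ji; suff -> : U *m (v i *m (v i)^T) = 0 by rewrite sub0mx.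
rewrite mulmxA; case/orP: Ji => [id|/eqP/U_null->]; last by rewrite mul0mx.
by rewrite (vspan_mul0 ov (submx_trans sub_envelope_score env_sub)) ?mul0mx.
Qed.

End Envelope.

(** * Score selection *)

(** The decreasing sort is the sorted positive entries followed by the sorted others, so the entry
    at index [count - 1] is the least positive one. *)
Lemma nth_sort_count (R : realDomainType) (s : seq R) :
  let g := nth 0 (sort >=%R s) (count (fun x => 0 < x)%R s).-1 in
  (0 < count (fun x => 0 < x)%R s)%N -> 0 < g /\ forall x, x \in s -> 0 < x -> g <= x.
Proof.
set c := count _ _ => /= c0.
pose t1 : seq R := sort >=%R (seq.filter (fun x => 0 < x)%R s).
pose t2 : seq R := sort >=%R (seq.filter (predC (fun x => 0 < x)%R) s).
have tr : transitive (>=%R : rel R) by exact: ge_trans.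
have tot : total (>=%R : rel R) by exact: ge_total.
have sz1 : size t1 = c by rewrite size_sort size_filter.
have sE : sort >=%R s = t1 ++ t2.
  apply: (sorted_eq tr).
  - exact: ge_anti.
  - exact: sort_sorted.
  - rewrite sorted_pairwise// pairwise_cat -!sorted_pairwise// !sort_sorted//= !andbT.
    apply/allrelP => x y; rewrite !mem_sort !mem_filter /= -leNgt.
    by move=> /andP[x0 _] /andP[y0 _]; exact: le_trans y0 (ltW x0).
  - rewrite perm_sort -(perm_filterC (fun x => 0 < x)%R s).
    by rewrite perm_cat// perm_sym perm_sort.
rewrite sE nth_cat sz1 prednK// leqnn.
have g1 : nth 0 t1 c.-1 \in t1 by rewrite mem_nth// sz1 prednK.
split=> [|x xs x0].
  by move: g1; rewrite mem_sort mem_filter => /andP[].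
have xt : x \in t1 by rewrite mem_sort mem_filter /= x0.
rewrite -[x in _ <= x](nth_index 0 xt).
apply: (sorted_leq_nth tr) => //; first exact: lexx.
- exact: sort_sorted.
- by rewrite inE index_mem.
- by rewrite inE sz1 prednK.
- by rewrite -ltnS prednK// -sz1 index_mem.
Qed.

(** * Deterministic error bound for sparse NIECE *)

Section SparseNIECE.
Variables (R : realType) (p r d u : nat).
Variables (M A E Eh : 'M[R]_r) (N Nh : 'M[R]_(p, r)).
Variables (lam : 'I_r -> R) (v : 'I_r -> 'cV[R]_r).
Variables (L delta tau e : R).
Hypothesis eig : eigensystem M lam v.
Hypothesis sM : M^T = M.
Hypothesis lam_ge0 : forall i, 0 <= lam i.
Hypothesis lam_le : forall i, lam i <= L.
Hypothesis delta_gt0 : 0 < delta.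
Hypothesis gap : forall i j : 'I_r,
  (i < d)%N -> j = i.+1 :> nat -> delta <= lam i - lam j.
Hypothesis d_lt_r : (d < r)%N.
Hypothesis v_l1 : forall j : 'I_r, (j < d)%N -> l1norm (v j) <= tau.
Hypothesis A_M : forall i j, `|A i j - M i j| <= e.
Hypothesis Nh_N : forall i j, `|Nh i j - N i j| <= e.
Hypothesis N_le : forall a x, (N *m x) a 0 ^+ 2 <= L ^+ 2 * dotp x x.
Hypothesis E_def : E = envelope M (N^T *m N).
Hypothesis rE : \rank E = u.
Hypothesis u_gt0 : (0 < u)%N.
Hypothesis E_sub : (E <= vspan v (fun j => (j < d)%N))%MS.
Hypothesis Eh_def : sparse_NIECE d u tau A (Nh^T *m Nh) Eh.

Let ov : orthonormal v := eigensystem_orthonormal eig.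
Let eta := tau ^+ 2 * e.
Let C := PMD_const L delta d.
Let J : pred 'I_r := fun j => (j < d)%N && (quad (N^T *m N) (v j) != 0).
Let Delta := score_gap d u (N^T *m N) v.

Lemma quad_gram m (W : 'M[R]_(m, r)) x :
  quad (W^T *m W) x = \sum_a (W *m x) a 0 ^+ 2.
Proof.
rewrite /quad !mulmxA -mulmxA -trmx_mul mxE.
by apply: eq_bigr => a _; rewrite mxE expr2.
Qed.

Lemma quad_gram_ge0 m (W : 'M[R]_(m, r)) x : 0 <= quad (W^T *m W) x.
Proof. by rewrite quad_gram; apply: sumr_ge0 => a _; rewrite sqr_ge0. Qed.

Lemma gram_null m (W : 'M[R]_(m, r)) x :
  quad (W^T *m W) x = 0 -> W^T *m W *m x = 0.
Proof.
rewrite quad_gram => /eqP; rewrite psumr_eq0 => [/allP W0|a _]; last exact: sqr_ge0.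
suff -> : W^T *m W *m x = W^T *m 0 by rewrite mulmx0.
rewrite -mulmxA; congr (_ *m _); apply/matrixP => a b; rewrite ord1 [RHS]mxE.
by apply/eqP; have := W0 a; rewrite mem_index_enum sqrf_eq0 => /(_ isT).
Qed.

Lemma envelope_vspan : (E :=: vspan v J)%MS.
Proof.
rewrite E_def; apply: (envelopeE eig sM) => //.
- by rewrite trmx_mul trmxK.
- exact: gram_null.
- by move=> i j id jE; rewrite -subr_gt0 (lt_le_trans delta_gt0)// gap.
- by rewrite -E_def.
Qed.

Lemma card_scores : #|J| = u.
Proof. by rewrite -rE envelope_vspan mxrank_vspan. Qed.

(** Exactly [u] of the first [d] scores are positive, because they index a basis of [E]; the u-th
    largest score is then the smallest positive one. *)
Lemma score_gapP :
  0 < Delta /\ forall j, J j -> Delta <= quad (N^T *m N) (v j).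
Proof.
rewrite /Delta /score_gap.
set s := map _ _.
have cs : count (fun x => 0 < x)%R s = u.
  rewrite count_map count_filter enumT -card_scores cardE /enum_mem size_filter.
  apply: eq_count => j; rewrite /= /in_mem /= /J andbC; congr andb.
  by rewrite lt_def quad_gram_ge0 andbT.
have := @nth_sort_count _ s; rewrite cs => /(_ u_gt0)[g0 gle].
split=> // j /andP[jd Uj]; apply: gle; last by rewrite lt_def Uj quad_gram_ge0.
by apply: map_f; rewrite mem_filter jd mem_enum.
Qed.

Let e_ge0 : 0 <= e.
Proof.
have r0 : (0 < r)%N by exact: leq_ltn_trans d_lt_r.
exact: le_trans (normr_ge0 _) (A_M (Ordinal r0) (Ordinal r0)).
Qed.

Let L_ge0 : 0 <= L.
Proof.
have r0 : (0 < r)%N by exact: leq_ltn_trans d_lt_r.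
exact: le_trans (lam_ge0 (Ordinal r0)) (lam_le _).
Qed.

(** As [u > 0], some unit vector [v j] with [j < d] exists, and its l1-norm dominates its Euclidean
    norm. *)
Let tau_ge1 : 1 <= tau.
Proof.
have : (0 < #|J|)%N by rewrite card_scores.
case/card_gt0P => j /andP[jd _].
apply: le_trans (v_l1 jd); rewrite -ler_sqr ?nnegrE ?l1norm_ge0//.
by rewrite expr1n; apply: le_trans (dotp_le_l1 _); rewrite ov eqxx.
Qed.

Let eta_ge0 : 0 <= eta. Proof. by rewrite mulr_ge0 ?sqr_ge0. Qed.

Let C_ge0 : 0 <= C. Proof. exact: PMD_const_ge0. Qed.

(** Passing from [Nh x] to [N x] costs at most [tau * e <= eta]. Passing from [x] to [y] uses
    [x = c y] plus a remainder of norm at most [m = sqrt (1 - c^2)], of order [sqrt eta]. Comparing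
    squares absorbs the sign ambiguity of eigenvectors. *)
Lemma score_coord a (x y : 'cV[R]_r) : dotp x x <= 1 -> dotp y y = 1 ->
  l1norm x <= tau -> 1 - dotp x y ^+ 2 <= C * eta -> eta <= 1 ->
  `|(Nh *m x) a 0 ^+ 2 - (N *m y) a 0 ^+ 2|
    <= (2 * L + 1 + 4 * L ^+ 2 * Num.sqrt C) * Num.sqrt eta.
Proof.
move=> x1 y1 xt cxy eta1; set c := dotp x y in cxy.
set hh := (Nh *m x) a 0; set h := (N *m y) a 0; set k := (N *m x) a 0.
have c1 : c ^+ 2 <= 1.
  by apply: le_trans (dotp_CS _ _) _; rewrite y1 mulr1.
have q0 := sqrtr_ge0 eta; have qE := sqr_sqrtr eta_ge0.
have q1 : Num.sqrt eta <= 1 by rewrite -sqrtr1 ler_wsqrtr.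
have etaq : eta <= Num.sqrt eta by rewrite -{1}qE expr2 ler_piMl.
have dk : `|hh - k| <= eta.
  apply: le_trans (_ : tau * e <= _); last first.
    by rewrite /eta expr2 -mulrA ler_peMl// mulr_ge0// (le_trans _ tau_ge1).
  have -> : hh - k = dotp x ((row a (Nh - N))^T).
    rewrite /hh /k !mxE -sumrB; apply: eq_bigr => j _.
    by rewrite !mxE mulrC mulrBr mulrC (mulrC (N _ _)).
  apply: le_trans (@dotp_max_l1 _ _ _ _ e _) _ => [i|]; last by rewrite ler_wpM2r.
  by rewrite !mxE.
have kL : `|k| <= L.
  apply: sqr_le_norm => //; apply: le_trans (N_le _ _) _.
  by rewrite ler_piMr// sqr_ge0.
have hL : `|h| <= L.
  by apply: sqr_le_norm => //; apply: le_trans (N_le _ _) _; rewrite y1 mulr1.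
have T1 : `|hh ^+ 2 - k ^+ 2| <= (2 * L + 1) * Num.sqrt eta.
  rewrite subr_sqr normrM mulrC; apply: ler_pM => //; last exact: le_trans etaq.
  rewrite (_ : hh + k = (hh - k) + 2 * k); last by ring.
  apply: le_trans (ler_normD _ _) _; rewrite normrM (ger0_norm (ler0n _ 2)).
  lra.
pose m := Num.sqrt (1 - c ^+ 2).
have mE : m ^+ 2 = 1 - c ^+ 2 by rewrite sqr_sqrtr// subr_ge0.
have m0 : 0 <= m := sqrtr_ge0 _.
have m1 : m <= 1 by rewrite -sqrtr1 ler_wsqrtr// gerBl sqr_ge0.
have mC : m <= Num.sqrt C * Num.sqrt eta by rewrite -sqrtrM// ler_wsqrtr.
have T2 : `|k ^+ 2 - h ^+ 2| <= 4 * L ^+ 2 * m.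
  pose g := (N *m (x - c *: y)) a 0.
  have kE : k = c * h + g.
    suff -> : g = k - c * h by ring.
    by rewrite /g mulmxBr -scalemxAr mxE [X in _ + X]mxE [X in - X]mxE.
  have gL : `|g| <= L * m.
    apply: sqr_le_norm; first exact: mulr_ge0.
    apply: le_trans (N_le _ _) _; rewrite exprMn ler_wpM2l ?sqr_ge0//.
    rewrite dotpBl !dotpBr !dotpZl !dotpZr y1 (dotpC y) -/c mE; nra.
  have -> : k ^+ 2 - h ^+ 2 = - (m ^+ 2 * h ^+ 2) + 2 * c * h * g + g ^+ 2.
    by rewrite mE kE; ring.
  apply: le_trans (ler_normD _ _) _.
  have G2 : `|g ^+ 2| <= L ^+ 2 * m.
    rewrite normrX; apply: le_trans (_ : (L * m) ^+ 2 <= _).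
      by rewrite ler_sqr ?nnegrE// mulr_ge0.
    by rewrite exprMn ler_wpM2l ?sqr_ge0// expr2 ler_piMl.
  have G1 : `|2 * c * h * g| <= 2 * L ^+ 2 * m.
    have c1' : `|c| <= 1 by apply: sqr_le_norm => //; rewrite expr1n.
    rewrite !normrM (ger0_norm (ler0n _ 2)).
    have hg : `|h| * `|g| <= L * (L * m) by exact: ler_pM.
    have := ler_piMl (mulr_ge0 (normr_ge0 h) (normr_ge0 g)) c1'; lra.
  have G0 : `|- (m ^+ 2 * h ^+ 2)| <= L ^+ 2 * m.
    rewrite normrN normrM !normrX (ger0_norm m0) mulrC.
    have h2 : `|h| ^+ 2 <= L ^+ 2 by rewrite ler_sqr ?nnegrE.
    have m2 : m ^+ 2 <= m by rewrite expr2 ler_piMl.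
    by apply: ler_pM => //; exact: sqr_ge0.
  by have := ler_normD (- (m ^+ 2 * h ^+ 2)) (2 * c * h * g); lra.
rewrite -(subrK (k ^+ 2) (hh ^+ 2)) -addrA; apply: le_trans (ler_normD _ _) _.
have : 4 * L ^+ 2 * m <= 4 * L ^+ 2 * (Num.sqrt C * Num.sqrt eta).
  by rewrite ler_wpM2l// mulr_ge0 ?sqr_ge0.
lra.
Qed.

Lemma sparse_NIECE_error : eta <= 1 ->
  p%:R * (2 * L + 1 + 4 * L ^+ 2 * Num.sqrt C) * Num.sqrt eta <= Delta / 3 ->
  frobenius (orthproj Eh - orthproj E) ^+ 2 <= 2 * (u%:R * (C * eta)).
Proof.
move=> eta1 small; have [Delta0 DeltaJ] := score_gapP.
have [vh pmd [Jh [cJh Jhsel EhE]]] := Eh_def.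
have vhv := PMD_eigenvectors eig sM lam_ge0 lam_le delta_gt0 gap d_lt_r v_l1 A_M pmd.
rewrite -/C -/eta in vhv.
pose w := widen_ord (ltnW d_lt_r).
have wd i : (w i < d)%N by exact: (ltn_ord i).
have score (i : 'I_d) :
    `|quad (Nh^T *m Nh) (vh i) - quad (N^T *m N) (v (w i))| <= Delta / 3.
  apply: le_trans small; rewrite !quad_gram -sumrB.
  apply: le_trans (ler_norm_sum _ _ _) _.
  rewrite -mulrA -[X in X%:R](card_ord p) mulr_natl -sumr_const.
  apply: ler_sum => a _; apply: score_coord => //.
  - exact: PMD_norm_le1 pmd _ _.
  - by rewrite ov eqxx.
  - exact: PMD_l1 pmd _ _.
  - exact: (vhv (w i)).
pose J' : {set 'I_d} := finset (fun i => J (w i)).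
have cJ' : #|J'| = u.
  have winj : injective w by move=> i j /(congr1 val) ij; exact: val_inj.
  rewrite -card_scores -(card_imset _ winj).
  apply: eq_card => j; apply/imsetP/idP => [[i + ->]|Jj].
    by rewrite inE.
  have /andP[jd _] := Jj; exists (Ordinal jd); last exact: val_inj.
  by rewrite inE (_ : w _ = j)//; exact: val_inj.
(* By equal cardinality, a wrongly selected [i] leaves out some [j] of [J']. The sample score of [j]
   is at least [2 Delta / 3] and that of [i] at most [Delta / 3], against the selection rule. *)
have JhJ' : Jh = J'.
  apply/eqP; rewrite eqEcard cJh cJ' leqnn andbT; apply/fintype.subsetP => i iJh.
  apply/negPn/negP => iJ'.
  have : ~~ (J' \subset Jh).
    apply/negP => J'Jh; have /eqP J'E : J' == Jh by rewrite eqEcard J'Jh cJh cJ' /=.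
    by rewrite J'E iJh in iJ'.
  case/fintype.subsetPn => j jJ' jJh.
  have := Jhsel i j iJh jJh; have := score i; have := score j.
  have := DeltaJ (w j); move: jJ' iJ'; rewrite !inE => Jj /[swap] /(_ Jj) Dj.
  rewrite /J wd /= negbK => /eqP->; rewrite !ler_norml subr0 => /andP[? _] /andP[_ ?].
  by move=> ?; lra.
have rEh : (\rank Eh <= #|J|)%N.
  rewrite EhE card_scores -cJh -sum1_card.
  apply: leq_trans (mxrank_sum_leqif _) _ => /=.
  by apply: leq_sum => j _; rewrite genmxE rank_leq_row.
apply: le_trans (frobenius_orthproj ov envelope_vspan rEh) _.
rewrite ler_wpM2l// -card_scores mulr_natl -sumr_const; apply: ler_sum => j Jj.
have /andP[jd _] := Jj; pose i := Ordinal jd.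
have wi : w i = j by exact: val_inj.
have iJh : i \in Jh by rewrite JhJ' inE wi.
(* With this multiple of [vh j], the difference from [v j] is [deflate (vh j) (v j)], whose squared
   norm is at most [1 - <vh j, v j>^2]. *)
have vhE : ((dotp (vh j) (v j) *: vh j)^T <= Eh)%MS.
  rewrite linearZ /= scalemx_sub// EhE; apply: (sumsmx_sup i) => //.
  by rewrite genmxE.
have := quad_orthproj (v j) vhE; rewrite ov eqxx => H; apply: le_trans H _.
apply: le_trans (vhv j jd); apply: le_trans (deflate_dotp _ _) _.
  exact: PMD_norm_le1 pmd _ jd.
by rewrite ov eqxx.
Qed.

End SparseNIECE.

(** * Sub-exponential variables *)

Section ExponentialMoments.
Context (R : realType) (disp : measure_display) (T : measurableType disp).
Variable P : probability T R.

Lemma measurable_ge (V : T -> R) (t : R) : measurable_fun setT V ->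
  measurable [set x | t <= V x].
Proof.
move=> mV; have -> : [set x | t <= V x] = V @^-1` `[t, +oo[%classic.
  by apply/seteqP; split => x /=; rewrite in_itv /= andbT.
by rewrite -[X in measurable X]setTI; exact: mV.
Qed.

Lemma measurable_expR_comp (V : T -> R) : measurable_fun setT V ->
  measurable_fun setT (fun x => expR (V x)).
Proof. by move=> mV; exact: measurableT_comp. Qed.

(** The value of the series [\sum_n expR ((n + 1) / 2) * expR (- n)]. *)
Definition exp_tail_const : R := expR 2^-1 / (1 - expR (- 2^-1)).

Lemma exp_tail_const_ge0 : 0 <= exp_tail_const.
Proof.
by rewrite divr_ge0 ?expR_ge0// subr_ge0 expR_le1 oppr_le0 invr_ge0.
Qed.

(** Discretization at the integers: [expR (V / 2)] is at most the sum over [n] of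
    [expR ((n + 1) / 2)] on [V >= n], already by its term at the integer part of [V]. Integrating
    term by term gives a geometric series. *)
Lemma exp_moment_tail (V : T -> R) (b : R) : measurable_fun setT V ->
  (forall x, 0 <= V x) -> 0 <= b ->
  (forall t : R, 0 <= t -> (P [set x | (t <= V x)%R] <= (b * expR (- t))%:E)%E) ->
  (\int[P]_x (expR (V x / 2))%:E <= (b * exp_tail_const)%:E)%E.
Proof.
move=> mV V0 b0 tailV.
pose A (n : nat) := [set x | n%:R <= V x].
have mA n : measurable (A n) by exact: measurable_ge.
pose f (n : nat) x : \bar R := (expR (n.+1%:R / 2) * \1_(A n) x)%:E.
have f0 n x : (0 <= f n x)%E by rewrite lee_fin mulr_ge0 ?expR_ge0.
have mf n : measurable_fun setT (f n).
  by apply/measurable_EFinP; apply: measurable_funM.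
apply: (@le_trans _ _ (\int[P]_x (\sum_(n <oo) f n x))%E).
  apply: ge0_le_integral => //.
  - by apply/measurable_EFinP/measurable_expR_comp; exact: measurable_funM.
  - exact: (ge0_emeasurable_sum (fun n x _ _ => f0 n x) (fun n _ => mf n)).
  move=> x _; pose m := Num.trunc (V x).
  have /andP[mV1 mV2] := truncn_itv (V0 x).
  apply: le_trans (nneseries_lim_ge m.+1 _) => [|n _ _]; last exact: f0.
  rewrite big_nat_recr//= -[leLHS]add0e; apply: leeD; first exact: sume_ge0.
  by rewrite lee_fin indicE mem_set//= mulr1 ler_expR ler_pM2r// ltW.
rewrite integral_nneseries//.
pose q : R := expR (- 2^-1).
have q0 : 0 < q by exact: expR_gt0.
have q1 : `|q| < 1 by rewrite gtr0_norm// expR_lt1 oppr_lt0 invr_gt0.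
have a0 : 0 <= b * expR 2^-1 by rewrite mulr_ge0 ?expR_ge0.
apply: (@le_trans _ _ (\sum_(n <oo) (geometric (b * expR 2^-1) q n)%:E)%E).
  apply: lee_nneseries => [n _ _|n _]; first exact: integral_ge0.
  rewrite /f; under eq_integral do rewrite EFinM.
  rewrite ge0_integralZl_EFin ?expR_ge0//; last exact/measurable_EFinP.
  rewrite integral_indic// setIT.
  apply: le_trans (lee_wpmul2l _ (tailV n%:R _)) _; rewrite ?lee_fin ?expR_ge0//.
  rewrite /= /q -expRM_natl -!mulrA (mulrCA _ b) ler_wpM2l// -!expRD ler_expR.
  by rewrite -natr1; lra.
apply: lime_le.
  apply: is_cvg_nneseries => n _ _; rewrite lee_fin.
  by apply: geometric_ge0 => //; exact: ltW.
apply: nearW => n; rewrite sumEFin lee_fin mulrA.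
exact: (geometric_le_lim n a0 q0 q1).
Qed.

(** From [expR x - 1 <= x * expR x] follows [expR x - 1 - x <= x * (expR x - 1)], which is at most
    [x^2 expR x] for [x >= 0] and at most [x^2] for [x < 0]. *)
Lemma expR_le_quad (x : R) : expR x <= 1 + x + x ^+ 2 * expR `|x|.
Proof.
have e1 : expR x - 1 <= x * expR x.
  have := expR_ge1Dx (- x); have := expRxMexpNx_1 x; have := expR_gt0 x; nra.
have e2 := expR_ge1Dx x.
have e3 : 1 <= expR `|x| by rewrite -(expR0 R) ler_expR.
have sq := sqr_ge0 x.
have [x0|x0] := leP 0 x; first by rewrite ger0_norm// in e3 *; nra.
have : x * (expR x - 1) <= x ^+ 2 by nra.
have : x ^+ 2 <= x ^+ 2 * expR `|x| by rewrite ler_peMr.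
lra.
Qed.

Lemma sqr_le_expR (x : R) : 0 <= x -> x ^+ 2 <= 4 * expR x.
Proof.
move=> x0; have := expR_ge1Dxn 1 x0; rewrite (_ : 2`! = 2)%N//.
by have := sqr_ge0 x; lra.
Qed.

Lemma ge0_integrable (f : T -> R) (K : R) : measurable_fun setT f ->
  (forall x, 0 <= f x) -> (\int[P]_x (f x)%:E <= K%:E)%E ->
  P.-integrable setT (EFin \o f).
Proof.
move=> mf f0 fK; apply/integrableP; split; first exact/measurable_EFinP.
apply: le_lt_trans (ltry K); apply: le_trans fK.
by under eq_integral do rewrite /= ger0_norm//.
Qed.

Lemma integrable_EFinZ (f : T -> R) (k : R) : P.-integrable setT (EFin \o f) ->
  P.-integrable setT (EFin \o (fun x => k * f x)).
Proof. by move=> /(integrableZl measurableT k). Qed.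

Section SubExponential.
Variables (W : T -> R) (a K : R).
Hypotheses (mW : measurable_fun setT W) (a0 : 0 < a).
Hypothesis WK : (\int[P]_x (expR (a * `|W x|))%:E <= K%:E)%E.

Let mE : measurable_fun setT (fun x => expR (a * `|W x|)).
Proof.
apply: measurable_expR_comp; apply: measurable_funM => //.
exact: measurableT_comp.
Qed.

Let iE : P.-integrable setT (EFin \o (fun x => expR (a * `|W x|))).
Proof. by apply: ge0_integrable WK => // x; exact: expR_ge0. Qed.

Lemma sub_exp_integrable : P.-integrable setT (EFin \o W).
Proof.
apply: (le_integrable measurableT _ _ (integrable_EFinZ a^-1 iE)).
  exact/measurable_EFinP.
move=> x _ /=; rewrite lee_fin.
rewrite [leRHS]ger0_norm ?mulr_ge0 ?expR_ge0 ?invr_ge0 ?(ltW a0)//.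
by rewrite ler_pdivlMl//; apply: le_trans (expR_ge1Dx _); rewrite lerDr.
Qed.

(** Integrating [expR_le_quad] leaves a term quadratic in [s]; then [1 + y <= expR y] puts the bound
    in exponential form. *)
Lemma sub_exp_mgf (s m : R) : (\int[P]_x (W x)%:E = m%:E)%E -> `|s| <= a / 2 ->
  (\int[P]_x (expR (s * W x))%:E
    <= (expR (s * m + 16 * K / a ^+ 2 * s ^+ 2))%:E)%E.
Proof.
move=> Wm sa.
pose c := 16 / a ^+ 2 * s ^+ 2.
have c0 : 0 <= c by rewrite mulr_ge0 ?sqr_ge0// divr_ge0 ?sqr_ge0.
have pw x : expR (s * W x) <= 1 + s * W x + c * expR (a * `|W x|).
  apply: le_trans (expR_le_quad _) _; rewrite lerD2l normrM exprMn.
  set w := `|W x|; have w0 : 0 <= w by exact: normr_ge0.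
  have -> : W x ^+ 2 = w ^+ 2 by rewrite real_normK ?num_real.
  have h1 : expR (`|s| * w) <= expR (a * w / 2).
    by rewrite ler_expR mulrAC ler_wpM2r.
  (* This is [sqr_le_expR] at [a w / 2]; the other half of the exponent [a w] pays for [h1]. *)
  have h2 : w ^+ 2 <= 16 / a ^+ 2 * expR (a * w / 2).
    have aw : 0 <= a * w / 2 by rewrite divr_ge0// mulr_ge0// ltW.
    have H := sqr_le_expR aw; rewrite mulrAC ler_pdivlMr ?exprn_gt0//; lra.
  rewrite (_ : expR (a * w) = expR (a * w / 2) * expR (a * w / 2)); last first.
    by rewrite -expRD; congr expR; lra.
  have h3 : w ^+ 2 * expR (`|s| * w) <=
      16 / a ^+ 2 * expR (a * w / 2) * expR (a * w / 2).
    by apply: ler_pM; rewrite ?sqr_ge0 ?expR_ge0.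
  have := ler_wpM2l (sqr_ge0 s) h3; rewrite /c; lra.
have isW := integrable_EFinZ s sub_exp_integrable.
have icE := integrable_EFinZ c iE.
have i1 : P.-integrable setT (EFin \o cst (1 : R)).
  by apply: finite_measure_integrable_cst.
have i1W := integrableD measurableT i1 isW.
apply: (@le_trans _ _ (\int[P]_x ((1%:E + (s * W x)%:E)
    + (c * expR (a * `|W x|))%:E))%E).
  apply: ge0_le_integral => //.
  - exact/measurable_EFinP/measurable_expR_comp/measurable_funM.
  - apply/measurable_EFinP; apply: measurable_funD; last exact: measurable_funM.
    by apply: measurable_funD => //; exact: measurable_funM.
  - by move=> x _; rewrite lee_fin; exact: pw.
rewrite integralD// integralD// integral_cst//.
rewrite (eq_integral (fun x => s%:E * (W x)%:E)%E)//.
rewrite integralZl//; last exact: sub_exp_integrable.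
rewrite Wm (eq_integral (fun x => c%:E * (expR (a * `|W x|))%:E)%E)//.
rewrite integralZl//.
apply: (@le_trans _ _ (1 + (s * m)%:E + c%:E * K%:E)%E).
  apply: leeD; last exact: lee_wpmul2l.
  by apply: leeD; rewrite ?mul1e//; exact: probability_le1.
rewrite -!EFinM -!EFinD lee_fin.
apply: le_trans (expR_ge1Dx _); rewrite /c; lra.
Qed.

End SubExponential.

End ExponentialMoments.

(** * Expectation of a product of independent variables *)

Lemma cvg_prodr (R : realType) (I : Type) (r : seq I) (f : I -> nat -> R) (l : I -> R) :
  (forall i, f i @ \oo --> l i) ->
  (fun m => \prod_(i <- r) f i m) @ \oo --> \prod_(i <- r) l i.
Proof.
move=> fl; elim: r => [|i r IH].
  by under eq_fun do rewrite big_nil; rewrite big_nil; exact: cvg_cst.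
under eq_fun do rewrite big_cons; rewrite big_cons.
exact: cvgM (fl i) IH.
Qed.

Section IndependentProduct.
Import HBNNSimple.
Context (R : realType) (disp : measure_display) (T : measurableType disp).
Variable P : probability T R.
Variables (n : nat) (W : T -> R) (Ws : 'I_n -> T -> R).
Hypothesis mW : measurable_fun setT W.
Hypothesis mWs : forall i, measurable_fun setT (Ws i).
Hypothesis same_law : forall i (B : set R), measurable B ->
  P (Ws i @^-1` B) = P (W @^-1` B).
Hypothesis indep : forall B : 'I_n -> set R, (forall i, measurable (B i)) ->
  P [set t | forall i, B i (Ws i t)] = (\prod_i P (Ws i @^-1` B i))%E.

Let mpre (V : T -> R) (B : set R) : measurable_fun setT V -> measurable B ->
  measurable (V @^-1` B).
Proof. by move=> mV mB; rewrite -[X in measurable X]setTI; exact: mV. Qed.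

(** Distributing the product over the sums gives one term for each choice [f] of levels, an
    indicator of a rectangle event, whose probability factors by independence. *)
Lemma integral_prod_simple N (a : 'I_N -> R) (A : 'I_N -> set R) :
  (forall j, 0 <= a j) -> (forall j, measurable (A j)) ->
  (\int[P]_x (\prod_(i < n) \sum_(j < N) a j * \1_(A j) (Ws i x))%:E
    = ((\sum_(j < N) a j * fine (P (W @^-1` A j))) ^+ n)%:E)%E.
Proof.
move=> a0 mA.
pose S (f : {ffun 'I_n -> 'I_N}) := [set t | forall i, A (f i) (Ws i t)].
have mS f : measurable (S f).
  have -> : S f = \bigcap_(i in [set: 'I_n]) (Ws i @^-1` A (f i)).
    by apply/seteqP; split => [t St i _|t St i]; [exact: St|exact: (St i)].
  by apply: fin_bigcap_measurable => // i _; exact: mpre.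
have prodE x : \prod_(i < n) \sum_(j < N) a j * \1_(A j) (Ws i x)
    = \sum_(f : {ffun 'I_n -> 'I_N}) (\prod_i a (f i)) * \1_(S f) x.
  rewrite bigA_distr_bigA /=; apply: eq_bigr => f _.
  rewrite big_split /=; congr (_ * _); rewrite indicE.
  case: (boolP (x \in S f)) => [/set_mem Sx|Sx].
    by rewrite big1// => i _; rewrite indicE mem_set//; exact: Sx.
  have /existsNP[i Ai] : ~ (forall i, A (f i) (Ws i x)).
    by move=> Sfx; move/negP: Sx; apply; exact: mem_set.
  by rewrite (bigD1 i)//= indicE memNset//= mul0r.
under eq_integral do rewrite prodE -sumEFin.
rewrite ge0_integral_sum//; last first.
- move=> f x _; rewrite lee_fin mulr_ge0//.
  by apply: prodr_ge0 => i _.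
- by move=> f; apply/measurable_EFinP; apply: measurable_funM.
rewrite (eq_bigr (fun f : {ffun 'I_n -> 'I_N} =>
  (\prod_i (a (f i) * fine (P (W @^-1` A (f i)))))%:E)); last first.
  move=> f _; under eq_integral do rewrite EFinM.
  rewrite ge0_integralZl_EFin//; last 2 first.
  - exact/measurable_EFinP.
  - by apply: prodr_ge0 => i _.
  rewrite integral_indic// setIT [X in (_ * X)%E](indep (fun i => mA (f i))).
  rewrite big_split EFinM; congr (_ * _)%E.
  rewrite -prodEFin; apply: eq_bigr => i _.
  by rewrite same_law// fineK// fin_num_measure//; exact: mpre.
rewrite sumEFin; congr EFin.
rewrite -(bigA_distr_bigA (fun (_ : 'I_n) j => a j * fine (P (W @^-1` A j)))).
by rewrite prodr_const card_ord.
Qed.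

Lemma integral_simple N (a : 'I_N -> R) (A : 'I_N -> set R) :
  (forall j, 0 <= a j) -> (forall j, measurable (A j)) ->
  (\int[P]_x (\sum_(j < N) a j * \1_(A j) (W x))%:E
    = (\sum_(j < N) a j * fine (P (W @^-1` A j)))%:E)%E.
Proof.
move=> a0 mA; under eq_integral do rewrite -sumEFin.
have mI j : measurable_fun setT (fun x => \1_(A j) (W x) : R).
  exact: (measurableT_comp (@measurable_indic _ _ _ setT _ (mA j)) mW).
rewrite ge0_integral_sum//; last first.
- by move=> f x _; rewrite lee_fin mulr_ge0.
- by move=> j; apply/measurable_EFinP; apply: measurable_funM.
rewrite -sumEFin; apply: eq_bigr => j _.
under eq_integral do rewrite EFinM.
rewrite ge0_integralZl_EFin//; last exact/measurable_EFinP.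
have mWA := mpre mW (mA j).
rewrite EFinM fineK ?fin_num_measure//; congr (_ * _)%E.
by have := integral_indic P measurableT mWA; rewrite setIT => <-.
Qed.

(** Independence is given on rectangles. The product rule extends to simple functions and then, by
    monotone convergence, to a nonnegative measurable [g]. *)
Lemma integral_prod_le (g : R -> R) (c : R) : measurable_fun setT g ->
  (forall y, 0 <= g y) -> (\int[P]_x (g (W x))%:E <= c%:E)%E ->
  (\int[P]_x (\prod_(i < n) g (Ws i x))%:E <= (c ^+ n)%:E)%E.
Proof.
move=> mg g0 gc.
have mEg : measurable_fun setT (EFin \o g) by exact/measurable_EFinP.
pose h := nnsfun_approx measurableT mEg.
have h0 m y : 0 <= h m y by [].
have hcvg y : (fun m => h m y) @ \oo --> g y.
  have /fine_cvgP[_] : (EFin \o h^~ y) @ \oo --> (g y)%:E.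
    by apply: (cvg_nnsfun_approx measurableT mEg) => // z _; rewrite lee_fin.
  by [].
have hnd y : {homo (fun m => h m y) : m1 m2 / (m1 <= m2)%N >-> m1 <= m2}.
  by move=> m1 m2 m12; exact/lefP/nd_nnsfun_approx.
have hg m y : h m y <= g y.
  rewrite -(cvg_lim _ (hcvg y))//; apply: nondecreasing_cvgn_le (hnd y) _ m.
  by apply/cvg_ex; exists (g y).
pose s m := fset_set (range (h m)).
have hE m y : h m y = \sum_(j < #|`s m|) (s m)`_j * \1_(h m @^-1` [set (s m)`_j]) y.
  exact: fimfunEord.
have s0 m (j : 'I_#|`s m|) : 0 <= (s m)`_j.
  have : (s m)`_j \in s m by rewrite mem_nth.
  by rewrite in_fset_set// => /set_mem[z _ <-].
have mhs m (j : 'I_#|`s m|) : measurable (h m @^-1` [set (s m)`_j]).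
  exact: measurable_sfunP.
have step m : (\int[P]_x (\prod_(i < n) h m (Ws i x))%:E <= (c ^+ n)%:E)%E.
  under eq_integral do under eq_bigr do rewrite hE.
  rewrite (integral_prod_simple (s0 m) (mhs m)) lee_fin lerXn2r ?nnegrE//.
  - apply: sumr_ge0 => j _; rewrite mulr_ge0//; exact: fine_ge0.
  - rewrite -lee_fin; apply: le_trans gc.
    by apply: integral_ge0 => x _; rewrite lee_fin.
  rewrite -lee_fin -(integral_simple (s0 m) (mhs m)); apply: le_trans gc.
  apply: ge0_le_integral => //.
  - by move=> x _; rewrite -hE lee_fin.
  - apply/measurable_EFinP; under eq_fun do rewrite -hE.
    exact: measurableT_comp.
  - by apply/measurable_EFinP; exact: measurableT_comp.
  - by move=> x _; rewrite -hE lee_fin.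
pose F m x : \bar R := (\prod_(i < n) h m (Ws i x))%:E.
have F0 m x : (0 <= F m x)%E by rewrite lee_fin; apply: prodr_ge0.
have mF m : measurable_fun setT (F m).
  apply/measurable_EFinP; apply: measurable_prod => i _.
  exact: measurableT_comp.
have ndF x : {homo (fun m => F m x) : m1 m2 / (m1 <= m2)%N >-> (m1 <= m2)%E}.
  move=> m1 m2 m12; rewrite lee_fin; apply: ler_prod => i _.
  by rewrite h0 hnd.
have limF x : limn (fun m => F m x) = (\prod_(i < n) g (Ws i x))%:E.
  apply/cvg_lim => //; apply: cvg_EFin; first exact: nearW.
  by apply: (cvg_prodr (f := fun i m => h m (Ws i x))) => i; exact: hcvg.
under eq_integral do rewrite -limF.
rewrite monotone_convergence//; apply: lime_le; last exact: nearW.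
apply: ereal_nondecreasing_is_cvgn => m1 m2 m12.
by apply: ge0_le_integral => // x _; exact: ndF.
Qed.

End IndependentProduct.

(** * Concentration of sample means *)

Section Concentration.
Context (R : realType) (disp : measure_display) (T : measurableType disp).
Variable P : probability T R.

Lemma markov_ge (Y : T -> R) (c D : R) : measurable_fun setT Y ->
  (forall x, 0 <= Y x) -> 0 < c -> (\int[P]_x (Y x)%:E <= D%:E)%E ->
  (P [set x | (c <= Y x)%R] <= (D / c)%:E)%E.
Proof.
move=> mY Y0 c0 YD; set A := [set x | _].
have mA : measurable A by exact: measurable_ge.
have : (c%:E * P A <= D%:E)%E.
  apply: le_trans YD; have := integral_indic P measurableT mA; rewrite setIT => <-.
  rewrite -ge0_integralZl_EFin//; last 2 first.
  - exact/measurable_EFinP.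
  - exact: ltW.
  apply: ge0_le_integral => //.
  - by move=> x _; rewrite -EFinM lee_fin mulr_ge0// ltW.
  - by apply/measurable_EFinP; apply: measurable_funM.
  - exact/measurable_EFinP.
  - move=> x _; rewrite -EFinM lee_fin indicE.
    by case: (boolP (x \in A)) => [/set_mem Ax|_]; rewrite ?mulr1 ?mulr0.
have PA : P A \is a fin_num by exact: fin_num_measure.
rewrite -(fineK PA) -EFinM !lee_fin => H.
by rewrite ler_pdivlMr// mulrC.
Qed.

Variables (n : nat) (W : T -> R) (Ws : 'I_n -> T -> R) (a K m : R).
Hypothesis mW : measurable_fun setT W.
Hypothesis mWs : forall i, measurable_fun setT (Ws i).
Hypothesis same_law : forall i (B : set R), measurable B ->
  P (Ws i @^-1` B) = P (W @^-1` B).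
Hypothesis indep : forall B : 'I_n -> set R, (forall i, measurable (B i)) ->
  P [set t | forall i, B i (Ws i t)] = (\prod_i P (Ws i @^-1` B i))%E.
Hypothesis a0 : 0 < a.
Hypothesis K0 : 0 < K.
Hypothesis WK : (\int[P]_x (expR (a * `|W x|))%:E <= K%:E)%E.
Hypothesis Wm : (\int[P]_x (W x)%:E = m%:E)%E.
Let K' := 16 * K / a ^+ 2.

(** Markov's inequality for the exponential of [s] times the sum. Keeping the sign of [s] free
    covers both tails. *)
Lemma chernoff_sum (s t : R) : `|s| <= a / 2 ->
  (P [set x | (n%:R * (`|s| * t) <= s * (\sum_i Ws i x - n%:R * m))%R]
    <= (expR (n%:R * (K' * s ^+ 2 - `|s| * t)))%:E)%E.
Proof.
move=> sa.
have I := sub_exp_mgf mW a0 WK Wm sa.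
have ms : measurable_fun setT (fun y : R => expR (s * y)).
  exact/measurable_expR_comp/measurable_funM.
have := integral_prod_le mW mWs same_law indep ms (fun y => expR_ge0 _) I.
rewrite -/K' => H.
have mY : measurable_fun setT (fun x => \prod_(i < n) expR (s * Ws i x)).
  by apply: measurable_prod => i _; exact/measurable_expR_comp/measurable_funM.
have Y0 x : 0 <= \prod_(i < n) expR (s * Ws i x).
  by apply: prodr_ge0 => i _; exact: expR_ge0.
have := markov_ge mY Y0 (expR_gt0 (n%:R * (`|s| * t) + s * (n%:R * m))) H.
rewrite -expRM_natl -expRB.
rewrite (_ : [set x | _ <= \prod_(i < n) _] =
  [set x | (n%:R * (`|s| * t) <= s * (\sum_i Ws i x - n%:R * m))%R]).
  by move=> /le_trans; apply; rewrite lee_fin ler_expR; lra.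
by apply/seteqP; split => x /=; rewrite -expR_sum ler_expR -mulr_sumr mulrBr => ?; lra.
Qed.

Lemma mean_deviation (t : R) : (0 < n)%N -> 0 <= t -> t / (2 * K') <= a / 2 ->
  (P [set x | (t <= `|n%:R^-1 * (\sum_i Ws i x) - m|)%R]
    <= (2 * expR (- (n%:R * t ^+ 2 / (4 * K'))))%:E)%E.
Proof.
move=> n0 t0 ta; have K'0 : 0 < K' by rewrite divr_gt0 ?mulr_gt0 ?exprn_gt0.
(* The minimizer of [K' s^2 - s t], with value [- t^2 / (4 K')]; the hypothesis on [t] keeps it
   within the range of [chernoff_sum]. *)
set s := t / (2 * K') in ta.
have s0 : 0 <= s by rewrite divr_ge0// mulr_ge0// ltW.
have nn : 0 < n%:R :> R by rewrite ltr0n.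
have sa : `|s| <= a / 2 by rewrite ger0_norm.
have sNa : `|- s| <= a / 2 by rewrite normrN.
have U := chernoff_sum t sa; have D := chernoff_sum t sNa.
rewrite normrN sqrrN in D; rewrite (ger0_norm s0) in U D.
have E : n%:R * (K' * s ^+ 2 - s * t) = - (n%:R * t ^+ 2 / (4 * K')).
  by rewrite /s; field; rewrite gt_eqF.
rewrite E in U D.
have mS : measurable_fun setT (fun x => \sum_(i < n) Ws i x).
  by apply: measurable_sum => i.
have mset (u : R) :
    measurable [set x | (n%:R * (s * t) <= u * (\sum_i Ws i x - n%:R * m))%R].
  by apply: measurable_ge; apply: measurable_funM => //; exact: measurable_funB.
apply: (@le_trans _ _ (P ([set x | (n%:R * (s * t) <= s * (\sum_i Ws i x - n%:R * m))%R]
  `|` [set x | (n%:R * (s * t) <= - s * (\sum_i Ws i x - n%:R * m))%R]))).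
  apply: le_measure.
  - apply/mem_set.
    apply: (measurable_ge (V := fun x => `|n%:R^-1 * (\sum_i Ws i x) - m|)).
    apply: measurableT_comp => //.
    by apply: measurable_funB => //; exact: measurable_funM.
  - by apply/mem_set; exact: measurableU.
  move=> x /=; set S := \sum_i _.
  set z := n%:R^-1 * S - m.
  have zE : S - n%:R * m = n%:R * z.
    by rewrite /z mulrBr mulrA divff ?mul1r// gt_eqF.
  rewrite zE !(mulrCA _ n%:R z) !(ler_pM2l nn) ler_normr.
  case/orP => tz; [left|right]; first exact: ler_wpM2l.
  by rewrite mulNr -mulrN; exact: ler_wpM2l.
apply: le_trans (measureU2 _ _ _) _ => //.
by rewrite mulrDl mul1r EFinD; exact: leeD.
Qed.

End Concentration.

(** * Second moments of sub-Gaussian vectors *)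

Lemma col_mx_dotp (R : realType) p r (x x' : 'cV[R]_p) (y y' : 'cV[R]_r) :
  dotp (col_mx x y) (col_mx x' y') = dotp x x' + dotp y y'.
Proof.
rewrite /dotp big_split_ord /=; congr (_ + _); apply: eq_bigr => i _.
  by rewrite !col_mxEu.
by rewrite !col_mxEd.
Qed.

Lemma dotp_delta (R : realType) r (a : 'I_r) (x : 'cV[R]_r) :
  dotp (delta_mx a 0) x = x a 0.
Proof.
rewrite /dotp (bigD1 a)//= mxE !eqxx mul1r big1 ?addr0// => i ia.
by rewrite mxE (negPf ia) mul0r.
Qed.

Lemma l2norm_eq1 (R : realType) r (x : 'cV[R]_r) : dotp x x = 1 -> l2norm x = 1.
Proof.
move=> xx; apply/eqP; rewrite -(@eqrXn2 _ 2)// ?sqrtr_ge0//.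
by rewrite l2norm_sqr xx expr1n.
Qed.

Section Borel.
Context (R : realType) (m : nat).

Let cVm := g_sigma_algebraType [set A : set 'cV[R]_m | open A].

Lemma measurable_coord (a : 'I_m) :
  measurable_fun setT ((fun z => z a 0) : cVm -> R).
Proof.
apply: (measurability _ (RGenOpens.measurableE R)) => _ [_ [x [y ->]] <-].
rewrite setTI; apply: sub_sigma_algebra => /=.
have /continuousP := @coord_continuous R m 1 a 0; apply.
exact: interval_open.
Qed.

Lemma borel_coord_prod (a b : 'I_m) (B : set R) : measurable B ->
  borel ((fun z : 'cV[R]_m => z a 0 * z b 0) @^-1` B).
Proof.
move=> mB.
have mf := measurable_funM (measurable_coord a) (measurable_coord b).
by have := mf measurableT _ mB; rewrite setTI.
Qed.

Lemma borel_coord (a : 'I_m) (B : set R) : measurable B ->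
  borel ((fun z : 'cV[R]_m => z a 0) @^-1` B).
Proof. by move=> /(measurable_coord a measurableT); rewrite setTI. Qed.

End Borel.

Lemma measurable_rv_coord (R : realType) disp (T : measurableType disp) m
    (Z : T -> 'cV[R]_m) a :
  random_vector Z -> measurable_fun setT (fun x => Z x a 0).
Proof. by move=> Z_rv _ B mB; rewrite setTI; exact: Z_rv (borel_coord a mB). Qed.

Section SecondMoments.
Context (R : realType) (disp : measure_display) (T : measurableType disp).
Variable P : probability T R.
Variables (m : nat) (sigma : R) (Z : T -> 'cV[R]_m).
Hypothesis sigma_gt0 : 0 < sigma.
Hypothesis mZ : forall a, measurable_fun setT (fun x => Z x a 0).
Hypothesis subG : sub_gaussian P sigma Z.

Let c0 : R := exp_tail_const R.
Let c0_ge0 : 0 <= c0 := exp_tail_const_ge0 R.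
Let s2 : 0 < sigma ^+ 2. Proof. exact: exprn_gt0. Qed.

Lemma measurable_dotp w : measurable_fun setT (fun x => dotp w (Z x)).
Proof.
by apply: measurable_sum => i; apply: measurable_funM.
Qed.

Lemma dotp_tail w t : dotp w w = 1 -> 0 <= t ->
  (P [set x | (sigma * Num.sqrt t <= `|dotp w (Z x)|)%R] <= (2 * expR (- t))%:E)%E.
Proof.
move=> w1 t0; have st : 0 <= sigma * Num.sqrt t by rewrite mulr_ge0 ?sqrtr_ge0 ?ltW.
have := subG (l2norm_eq1 w1) st.
rewrite exprMn sqr_sqrtr// mulrAC divff ?gt_eqF// mul1r.
by under eq_set do rewrite -dotpE.
Qed.

Lemma measurable_tail w (u : R) : measurable [set x | u <= `|dotp w (Z x)|].
Proof.
apply: (measurable_ge (V := fun x => `|dotp w (Z x)|)).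
by apply: measurableT_comp => //; exact: measurable_dotp.
Qed.

Lemma exp_dotp_sqr w : dotp w w = 1 ->
  (\int[P]_x (expR (dotp w (Z x) ^+ 2 / sigma ^+ 2 / 2))%:E <= (2 * c0)%:E)%E.
Proof.
move=> w1; apply: exp_moment_tail => //.
- by apply: measurable_funM => //; apply: measurable_funX; exact: measurable_dotp.
- by move=> x; rewrite divr_ge0 ?sqr_ge0.
move=> t t0; apply: le_trans (dotp_tail w1 t0).
apply: le_measure; [apply/mem_set|apply/mem_set; exact: measurable_tail|].
  apply: measurable_ge; apply: measurable_funM => //; apply: measurable_funX.
  exact: measurable_dotp.
move=> x /=; rewrite ler_pdivlMr// => H.
rewrite -ler_sqr ?nnegrE ?mulr_ge0 ?sqrtr_ge0 ?(ltW sigma_gt0)//.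
by rewrite exprMn sqr_sqrtr// real_normK ?num_real// mulrC.
Qed.

(** If the product of two moduli is at least [sigma^2 t], one factor is at least [sigma sqrt t];
    hence a tail [4 expR (- t)]. *)
Lemma exp_coord_prod a b :
  (\int[P]_x (expR ((2 * sigma ^+ 2)^-1 * `|Z x a 0 * Z x b 0|))%:E <= (4 * c0)%:E)%E.
Proof.
pose V x := `|Z x a 0 * Z x b 0| / sigma ^+ 2.
have mV : measurable_fun setT V.
  apply: measurable_funM => //; apply: measurableT_comp => //.
  by apply: measurable_funM; exact: mZ.
have -> : (fun x => (expR ((2 * sigma ^+ 2)^-1 * `|Z x a 0 * Z x b 0|))%:E)
    = (fun x => (expR (V x / 2))%:E).
  apply/funext => x; congr (expR _)%:E; rewrite /V invfM; ring.
apply: exp_moment_tail => //; first by move=> x; rewrite divr_ge0 ?sqr_ge0.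
move=> t t0.
have u1 (c : 'I_m) : dotp (delta_mx c 0) (delta_mx c 0) = 1 :> R.
  by rewrite dotp_delta mxE !eqxx.
have Ta := dotp_tail (u1 a) t0; have Tb := dotp_tail (u1 b) t0.
apply: (@le_trans _ _ (P ([set x | sigma * Num.sqrt t <= `|dotp (delta_mx a 0) (Z x)|]
   `|` [set x | sigma * Num.sqrt t <= `|dotp (delta_mx b 0) (Z x)|]))).
  apply: le_measure; [apply/mem_set; exact: measurable_ge| |].
    by apply/mem_set/measurableU; exact: measurable_tail.
  move=> x /=; rewrite !dotp_delta /V ler_pdivlMr// normrM => H.
  have q0 : 0 <= sigma * Num.sqrt t by rewrite mulr_ge0 ?sqrtr_ge0 ?ltW.
  have [|la] := leP (sigma * Num.sqrt t) `|Z x a 0|; [by left|right].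
  rewrite leNgt; apply/negP => lb.
  have : `|Z x a 0| * `|Z x b 0| < (sigma * Num.sqrt t) ^+ 2.
    by rewrite expr2; apply: ltr_pM.
  by rewrite exprMn sqr_sqrtr// (mulrC _ t) ltNge H.
apply: le_trans (measureU2 _ _ _) _; [exact: measurable_tail|exact: measurable_tail|].
rewrite (_ : 4 * expR (- t) = 2 * expR (- t) + 2 * expR (- t)); last by ring.
by rewrite EFinD; exact: leeD.
Qed.

Lemma integrable_coord_prod a b :
  P.-integrable setT (EFin \o (fun x => Z x a 0 * Z x b 0)).
Proof.
apply: sub_exp_integrable (exp_coord_prod a b).
- by apply: measurable_funM; exact: mZ.
- by rewrite invr_gt0 mulr_gt0.
Qed.

Definition second_moment : 'M[R]_m :=
  \matrix_(a, b) fine (\int[P]_x (Z x a 0 * Z x b 0)%:E)%E.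

Lemma integral_coord_prod a b :
  (\int[P]_x (Z x a 0 * Z x b 0)%:E = (second_moment a b)%:E)%E.
Proof.
rewrite mxE fineK//.
exact: (integrable_fin_num measurableT (integrable_coord_prod a b)).
Qed.

Lemma second_moment_tr : second_moment^T = second_moment.
Proof.
apply/matrixP => a b; rewrite !mxE; congr fine.
by apply: eq_integral => x _; rewrite mulrC.
Qed.

Lemma quad_second_moment w :
  (\int[P]_x (dotp w (Z x) ^+ 2)%:E = (quad second_moment w)%:E)%E.
Proof.
have E x : (dotp w (Z x) ^+ 2)%:E =
    (\sum_(ab : 'I_m * 'I_m) (w ab.1 0 * w ab.2 0)%:E
      * (Z x ab.1 0 * Z x ab.2 0)%:E)%E.
  under [RHS]eq_bigr do rewrite -EFinM; rewrite sumEFin; congr EFin.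
  rewrite expr2 /dotp big_distrlr /= pair_bigA /=; apply: eq_bigr => -[a b] _ /=.
  by ring.
under eq_integral do rewrite E.
rewrite integral_sum//; last first.
  by move=> ab; apply: integrableZl => //; exact: integrable_coord_prod.
rewrite (eq_bigr (fun ab : 'I_m * 'I_m =>
    (w ab.1 0 * w ab.2 0 * second_moment ab.1 ab.2)%:E)); last first.
  move=> ab _; rewrite integralZl//; last exact: integrable_coord_prod.
  by rewrite integral_coord_prod.
rewrite sumEFin quadE /dotp.
rewrite -(pair_bigA _ (fun a b => w a 0 * w b 0 * second_moment a b)) /=.
congr EFin; apply: eq_bigr => a _; rewrite !mxE mulr_sumr; apply: eq_bigr => b _.
by rewrite mulrA mulrAC.
Qed.

Lemma quad_second_moment_ge0 w : 0 <= quad second_moment w.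
Proof.
rewrite -lee_fin -quad_second_moment; apply: integral_ge0 => x _.
by rewrite lee_fin sqr_ge0.
Qed.

(** A dimension-free bound on the top eigenvalue: for unit [w], [y = <w, Z>^2] is at most
    [2 sigma^2 expR (y / (2 sigma^2))], whose mean is controlled by [exp_dotp_sqr]. Scaling does the
    rest. *)
Lemma quad_second_moment_le w :
  quad second_moment w <= 4 * c0 * sigma ^+ 2 * dotp w w.
Proof.
have unit v : dotp v v = 1 -> quad second_moment v <= 4 * c0 * sigma ^+ 2.
  move=> v1; rewrite -lee_fin -quad_second_moment.
  have H := exp_dotp_sqr v1.
  apply: (@le_trans _ _ (\int[P]_x ((2 * sigma ^+ 2)%:E
      * (expR (dotp v (Z x) ^+ 2 / sigma ^+ 2 / 2))%:E))%E).
    apply: ge0_le_integral => //.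
    - by move=> x _; rewrite lee_fin sqr_ge0.
    - by apply/measurable_EFinP; apply: measurable_funX; exact: measurable_dotp.
    - apply/measurable_EFinP; apply: measurable_funM => //.
      apply: measurable_expR_comp; apply: measurable_funM => //.
      apply: measurable_funM => //; apply: measurable_funX.
      exact: measurable_dotp.
    move=> x _; rewrite -EFinM lee_fin; set y := dotp _ _ ^+ 2.
    have := expR_ge1Dx (y / sigma ^+ 2 / 2).
    have := expR_gt0 (y / sigma ^+ 2 / 2); set e := expR _ => e0 He.
    have : y / sigma ^+ 2 / 2 <= e by lra.
    rewrite (_ : y / sigma ^+ 2 / 2 = y / (2 * sigma ^+ 2)); last first.
      by rewrite -mulrA -invfM (mulrC 2).
    by rewrite ler_pdivrMr ?mulr_gt0// (mulrC e).
  rewrite ge0_integralZl_EFin//; last 2 first.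
  - apply/measurable_EFinP; apply: measurable_expR_comp; apply: measurable_funM => //.
    apply: measurable_funM => //; apply: measurable_funX.
    exact: measurable_dotp.
  - by rewrite mulr_ge0// ltW.
  apply: le_trans (lee_wpmul2l _ H) _; first by rewrite lee_fin mulr_ge0// ltW.
  by rewrite -EFinM lee_fin; lra.
have [w0|w0] := eqVneq (dotp w w) 0.
  rewrite (dotp_eq0 w0) quadE mulmx0 /dotp !big1 ?mulr0// => i _;
  by rewrite mxE mul0r.
have wp : 0 < dotp w w by rewrite lt_def w0 dotp_ge0.
pose c := Num.sqrt (dotp w w).
have c2 : c ^+ 2 = dotp w w by rewrite sqr_sqrtr ?dotp_ge0.
have cp : 0 < c by rewrite sqrtr_gt0.
have n1 : dotp (c^-1 *: w) (c^-1 *: w) = 1.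
  by rewrite dotpZl dotpZr mulrA -invfM -expr2 c2 mulVf.
have := unit _ n1.
rewrite quadE -scalemxAr dotpZl dotpZr -quadE mulrA -invfM -expr2 c2.
by rewrite ler_pdivrMl// mulrC.
Qed.

(** Polarization: four times the bilinear form is the difference of the forms at [u + v] and
    [u - v], both between 0 and [4 L] for unit vectors. *)
Lemma second_moment_bilin u w : dotp u u = 1 ->
  dotp u (second_moment *m w) ^+ 2 <= (4 * c0 * sigma ^+ 2) ^+ 2 * dotp w w.
Proof.
set L := 4 * c0 * sigma ^+ 2; move=> u1.
have L0 : 0 <= L by rewrite mulr_ge0 ?sqr_ge0// mulr_ge0.
have bil v : dotp v v = 1 -> `|dotp u (second_moment *m v)| <= L.
  move=> v1; have H1 := quad_second_moment_le (u - v).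
  have H2 := quad_second_moment_le (u + v).
  have G1 := quad_second_moment_ge0 (u - v).
  have G2 := quad_second_moment_ge0 (u + v).
  have B1 := quadB u v second_moment_tr.
  have B2 : quad second_moment (u + v) = quad second_moment u
      + 2 * dotp u (second_moment *m v) + quad second_moment v.
    have := quadB u (- v) second_moment_tr.
    by rewrite opprK !quadE mulmxN dotpNr (dotpNl v) dotpNr opprK mulrN opprK.
  rewrite -/L !(dotpBl, dotpBr, dotpDl, dotpDr) u1 v1 (dotpC v u) in H1 H2.
  have uv : `|dotp u v| <= 1 by apply: dotp_norm_le1; rewrite ?u1 ?v1.
  rewrite ler_norml in uv; case/andP: uv => uv1 uv2.
  have H1' : L * (1 - dotp u v - (dotp u v - 1)) <= L * 4 by rewrite ler_wpM2l//; lra.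
  have H2' : L * (1 + dotp u v + (dotp u v + 1)) <= L * 4 by rewrite ler_wpM2l//; lra.
  by rewrite ler_norml; apply/andP; split; lra.
have [w0|w0] := eqVneq (dotp w w) 0.
  rewrite (dotp_eq0 w0) mulmx0 /dotp !big1 ?mulr0 ?expr0n// => i _.
    by rewrite mxE mul0r.
  by rewrite mxE mulr0.
have wp : 0 < dotp w w by rewrite lt_def w0 dotp_ge0.
pose c := Num.sqrt (dotp w w).
have c2 : c ^+ 2 = dotp w w by rewrite sqr_sqrtr ?dotp_ge0.
have cp : 0 < c by rewrite sqrtr_gt0.
have n1 : dotp (c^-1 *: w) (c^-1 *: w) = 1.
  by rewrite dotpZl dotpZr mulrA -invfM -expr2 c2 mulVf.
have := bil _ n1; rewrite -scalemxAr dotpZr.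
rewrite normrM gtr0_norm ?invr_gt0// ler_pdivrMl// => H; rewrite -c2.
rewrite -(real_normK (num_real (dotp _ _))) -exprMn ler_sqr ?nnegrE//.
  by rewrite mulrC.
by rewrite mulr_ge0// ltW.
Qed.

End SecondMoments.

(** * Simultaneous concentration of all sample second moments *)

Section SampleSecondMoments.
Context (R : realType) (disp : measure_display) (T : measurableType disp).
Variable P : probability T R.

Lemma covariance_centered (f g : T -> R) : ('E_P[f] = 0)%E -> ('E_P[g] = 0)%E ->
  covariance P f g = (\int[P]_x (f x * g x)%:E)%E.
Proof.
move=> f0 g0; rewrite covariance.unlock f0 g0 expectation.unlock.
apply: eq_integral => x _; transitivity (((f x - 0) * (g x - 0))%:E) => //.
by rewrite !subr0.
Qed.

Lemma union_bound (I : eqType) (s : seq I) (A : I -> set T) (c : R) :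
  (forall i, measurable (A i)) -> (forall i, (P (A i) <= c%:E)%E) ->
  measurable [set x | exists2 i, i \in s & A i x] /\
  (P [set x | exists2 i, i \in s & A i x] <= ((size s)%:R * c)%:E)%E.
Proof.
move=> mA PA; elim: s => [|i s [mU PU]].
  rewrite (_ : [set x | _] = set0); first by rewrite measure0 mul0r; split.
  by apply/seteqP; split => x //= [].
have -> : [set x | exists2 j, j \in i :: s & A j x]
    = A i `|` [set x | exists2 j, j \in s & A j x].
  apply/seteqP; split => x /=.
    by move=> [j]; rewrite in_cons => /predU1P[->|js]; [left|right; exists j].
  by move=> [Ai|[j js Aj]]; [exists i|exists j] => //; rewrite in_cons ?eqxx ?js ?orbT.
split; first exact: measurableU.
apply: le_trans (measureU2 _ _ _) _ => //.
by rewrite /= -natr1 mulrDl mul1r addrC EFinD; exact: leeD.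
Qed.

Variables (m n : nat) (sigma : R) (Z : T -> 'cV[R]_m) (Zs : 'I_n -> T -> 'cV[R]_m).
Hypothesis sigma_gt0 : 0 < sigma.
Hypothesis mZ : forall a, measurable_fun setT (fun x => Z x a 0).
Hypothesis subG : sub_gaussian P sigma Z.
Hypothesis Zs_iid : iid_copies P Z Zs.
Hypothesis n_gt0 : (0 < n)%N.

Let a : R := (2 * sigma ^+ 2)^-1.

(** The constant [K'] of the Chernoff bound, for the exponential moment of [exp_coord_prod]. *)
Definition deviation_const : R := 16 * (4 * exp_tail_const R) / a ^+ 2.

Lemma deviation_const_gt0 : 0 < deviation_const.
Proof.
have a0 : 0 < a by rewrite invr_gt0 mulr_gt0// exprn_gt0.
by rewrite divr_gt0 ?exprn_gt0// !mulr_gt0// divr_gt0 ?expR_gt0//.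
Qed.

Definition moment_error (t : R) (ij : 'I_m * 'I_m) : set T :=
  [set x | t <= `|n%:R^-1 * (\sum_k Zs k x ij.1 0 * Zs k x ij.2 0)
                  - second_moment P Z ij.1 ij.2|].

Lemma measurable_moment_error t ij : measurable (moment_error t ij).
Proof.
have [Zs_rv _ _] := Zs_iid.
apply: (measurable_ge (V := fun x =>
  `|n%:R^-1 * (\sum_k Zs k x ij.1 0 * Zs k x ij.2 0) - second_moment P Z ij.1 ij.2|)).
apply: measurableT_comp => //; apply: measurable_funB => //.
apply: measurable_funM => //; apply: measurable_sum => k.
by apply: measurable_funM; apply: measurable_rv_coord.
Qed.

Lemma moment_error_le t ij : 0 <= t -> t <= a * deviation_const ->
  (P (moment_error t ij)
    <= (2 * expR (- (n%:R * t ^+ 2 / (4 * deviation_const))))%:E)%E.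
Proof.
move=> t0 ta; have [Zs_rv Zs_law Zs_ind] := Zs_iid; case: ij => i j.
have a0 : 0 < a by rewrite invr_gt0 mulr_gt0// exprn_gt0.
have D0 := deviation_const_gt0.
apply: (mean_deviation (W := fun x => Z x i 0 * Z x j 0)
  (Ws := fun k x => Zs k x i 0 * Zs k x j 0) (a := a) (K := 4 * exp_tail_const R)) => //.
- by apply: measurable_funM; exact: mZ.
- by move=> k; apply: measurable_funM; apply: measurable_rv_coord.
- by move=> k B mB; exact: Zs_law (borel_coord_prod i j mB).
- move=> B mB.
  exact: (Zs_ind (fun k => (fun z : 'cV[R]_m => z i 0 * z j 0) @^-1` B k)
    (fun k => borel_coord_prod i j (mB k))).
- by move: D0; rewrite pmulr_lgt0 ?invr_gt0 ?exprn_gt0// pmulr_rgt0.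
- exact: (exp_coord_prod sigma_gt0 mZ subG).
- exact: (integral_coord_prod sigma_gt0 mZ subG).
- rewrite -/deviation_const; move: deviation_const D0 ta => D D0 ta.
  by rewrite ler_pdivrMr ?mulr_gt0//; lra.
Qed.

Definition moment_failure (t : R) : set T :=
  [set x | exists2 ij, ij \in enum {: 'I_m * 'I_m} & moment_error t ij x].

Lemma moment_failureP t : 0 <= t -> t <= a * deviation_const ->
  measurable (moment_failure t) /\
  (P (moment_failure t) <=
    ((m * m)%:R * (2 * expR (- (n%:R * t ^+ 2 / (4 * deviation_const)))))%:E)%E.
Proof.
move=> t0 ta.
have := @union_bound _ (enum {: 'I_m * 'I_m}) (moment_error t) _
  (measurable_moment_error t) (fun ij => moment_error_le ij t0 ta).
by rewrite -cardE card_prod card_ord.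
Qed.

Lemma moment_success t x i j : ~ moment_failure t x ->
  `|n%:R^-1 * (\sum_k Zs k x i 0 * Zs k x j 0) - second_moment P Z i j| < t.
Proof.
move=> nF; rewrite ltNge; apply/negP => H; apply: nF; exists (i, j) => //.
by rewrite mem_enum.
Qed.

End SampleSecondMoments.

(** * Sparse NIECE from one sample *)

Lemma sample_covE (R : realType) n a b
    (Z : 'I_n -> 'cV[R]_a) (W : 'I_n -> 'cV[R]_b) i j :
  sample_cov Z W i j = n%:R^-1 * (\sum_k Z k i 0 * W k j 0).
Proof.
rewrite /sample_cov mxE summxE; congr (_ * _); apply: eq_bigr => k _.
by rewrite mxE big_ord1 mxE.
Qed.

Lemma sample_cov_tr (R : realType) n a b
    (Z : 'I_n -> 'cV[R]_a) (W : 'I_n -> 'cV[R]_b) :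
  sample_cov W Z = (sample_cov Z W)^T.
Proof.
apply/matrixP => i j; rewrite [RHS]mxE !sample_covE; congr (_ * _).
by apply: eq_bigr => k _; rewrite mulrC.
Qed.

Section OneSample.
Context (R : realType) (disp : measure_display) (T : measurableType disp).
Variable P : probability T R.
Variables (p r d u n : nat) (sigma delta tau : R).
Variables (X : T -> 'cV[R]_p) (Y : T -> 'cV[R]_r).
Variables (Xs : 'I_n -> T -> 'cV[R]_p) (Ys : 'I_n -> T -> 'cV[R]_r).
Variables (M U E : 'M[R]_r) (lam : 'I_r -> R) (v : 'I_r -> 'cV[R]_r).
Variables (Mh Uh Eh : T -> 'M[R]_r).
Let Z x := col_mx (X x) (Y x).
Let Zs i x := col_mx (Xs i x) (Ys i x).
Hypothesis sigma_gt0 : 0 < sigma.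
Hypothesis X_rv : random_vector X.
Hypothesis Y_rv : random_vector Y.
Hypothesis EX0 : centered P X.
Hypothesis EY0 : centered P Y.
Hypothesis subG : sub_gaussian P sigma Z.
Hypothesis M_def : M = cross_cov P Y Y.
Hypothesis M_posdef : posdef M.
Hypothesis U_def : U = cross_cov P Y X *m cross_cov P X Y.
Hypothesis Mh_def : forall x, Mh x = sample_cov (Ys ^~ x) (Ys ^~ x).
Hypothesis Uh_def : forall x, Uh x =
  sample_cov (Ys ^~ x) (Xs ^~ x) *m sample_cov (Xs ^~ x) (Ys ^~ x).
Hypothesis eig : eigensystem M lam v.
Hypothesis E_def : E = envelope M U.
Hypothesis u_gt0 : (0 < u)%N.
Hypothesis dimE : \rank E = u.
Hypothesis d_lt_r : (d < r)%N.
Hypothesis E_sub : (E <= \sum_(j < r | (j < d)%N) <<(v j)^T>>)%MS.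
Hypothesis delta_gt0 : 0 < delta.
Hypothesis gap : forall i j : 'I_r,
  (i < d)%N -> j = i.+1 :> nat -> delta <= lam i - lam j.
Hypothesis tau_gt : max_l1norm d v < tau.
Hypothesis Eh_def : forall x, sparse_NIECE d u tau (Mh x) (Uh x) (Eh x).

Let N := cross_cov P X Y.
Let S := second_moment P Z.
Let L : R := 4 * exp_tail_const R * sigma ^+ 2.
Let ov : orthonormal v := eigensystem_orthonormal eig.
Let sM : M^T = M. Proof. by case: M_posdef. Qed.

Lemma measurable_col_mx (a : 'I_(p + r)) : measurable_fun setT (fun x => Z x a 0).
Proof.
rewrite /Z -(splitK a); case: (fintype.split a) => i /=.
  by under eq_fun do rewrite col_mxEu; exact: measurable_rv_coord.
by under eq_fun do rewrite col_mxEd; exact: measurable_rv_coord.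
Qed.

Let mZ := measurable_col_mx.

Lemma cross_cov_XY i j : N i j = S (lshift r i) (rshift p j).
Proof.
rewrite !mxE covariance_centered; [|exact: EX0|exact: EY0].
by under [in RHS]eq_integral do rewrite col_mxEu col_mxEd.
Qed.

Lemma cov_Y i j : M i j = S (rshift p i) (rshift p j).
Proof.
rewrite M_def !mxE covariance_centered; [|exact: EY0|exact: EY0].
by under [in RHS]eq_integral do rewrite !col_mxEd.
Qed.

Lemma UE : U = N^T *m N.
Proof.
by rewrite U_def; congr (_ *m _); apply/matrixP => i j; rewrite !mxE covarianceC.
Qed.

(** [N] and [M] are blocks of the second-moment matrix of the stacked vector, so both inherit its
    norm bound. *)
Lemma second_moment_mul (x : 'cV[R]_r) : S *m col_mx 0 x = col_mx (N *m x) (M *m x).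
Proof.
have -> : S = block_mx (ulsubmx S) N (dlsubmx S) M.
  rewrite -[LHS]submxK; congr block_mx; apply/matrixP => i j.
    by rewrite cross_cov_XY !mxE.
  by rewrite cov_Y !mxE.
by rewrite mul_block_col !mulmx0 !add0r.
Qed.

Lemma quad_M_le x : quad M x <= L * dotp x x.
Proof.
have := quad_second_moment_le sigma_gt0 mZ subG (col_mx 0 x).
rewrite -/S quadE second_moment_mul !col_mx_dotp -quadE.
have z0 k (w : 'cV[R]_k) : dotp 0 w = 0.
  by rewrite /dotp big1// => i _; rewrite mxE mul0r.
by rewrite !z0 !add0r.
Qed.

Lemma cross_cov_le a x : (N *m x) a 0 ^+ 2 <= L ^+ 2 * dotp x x.
Proof.
have z0 k (w : 'cV[R]_k) : dotp 0 w = 0.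
  by rewrite /dotp big1// => i _; rewrite mxE mul0r.
pose w : 'cV[R]_(p + r) := col_mx (delta_mx a 0) 0.
have u1 : dotp w w = 1.
  by rewrite col_mx_dotp z0 addr0 dotp_delta mxE !eqxx.
have := second_moment_bilin sigma_gt0 mZ subG (col_mx 0 x) u1.
by rewrite -/S second_moment_mul !col_mx_dotp !z0 addr0 add0r dotp_delta.
Qed.

Lemma eigenvalue_quad i : lam i = quad M (v i).
Proof. by have [_ _ Mv] := eig; rewrite quadE Mv dotpZr ov eqxx mulr1. Qed.

Lemma eigenvalue_ge0 i : 0 <= lam i.
Proof.
have [_ Mpos] := M_posdef; rewrite eigenvalue_quad ltW// Mpos//.
apply/eqP => v0; have := ov i i; rewrite v0 eqxx /dotp big1 => [/esym/eqP|j _].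
  by rewrite oner_eq0.
by rewrite mxE mul0r.
Qed.

Lemma eigenvalue_le i : lam i <= L.
Proof. by rewrite eigenvalue_quad; have := quad_M_le (v i); rewrite ov eqxx mulr1. Qed.

Lemma eigenvector_l1 (j : 'I_r) : (j < d)%N -> l1norm (v j) <= tau.
Proof.
move=> jd; apply: le_trans (ltW tau_gt); rewrite /max_l1norm.
exact: (le_bigmax_cond _ (fun j => l1norm (v j)) jd).
Qed.

Let E_def' : E = envelope M (N^T *m N). Proof. by rewrite -UE. Qed.

Lemma score_gap_gt0 : 0 < score_gap d u U v.
Proof.
by rewrite UE; case: (score_gapP eig sM delta_gt0 gap E_def' dimE u_gt0 E_sub).
Qed.

(** [Mh] and the sample cross-covariance are blocks of one sample second-moment matrix, so a single
    event puts both within [t] of their targets. *)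
Lemma frobenius_success t x : ~ moment_failure P Z Zs t x ->
  tau ^+ 2 * t <= 1 ->
  p%:R * (2 * L + 1 + 4 * L ^+ 2 * Num.sqrt (PMD_const L delta d))
    * Num.sqrt (tau ^+ 2 * t) <= score_gap d u U v / 3 ->
  frobenius (orthproj (Eh x) - orthproj E) ^+ 2
    <= 2 * (u%:R * (PMD_const L delta d * (tau ^+ 2 * t))).
Proof.
move=> ok; rewrite UE.
apply: (sparse_NIECE_error (A := Mh x) (Nh := sample_cov (Xs ^~ x) (Ys ^~ x))
  eig sM eigenvalue_ge0 eigenvalue_le delta_gt0 gap d_lt_r eigenvector_l1) => //.
- move=> i j; rewrite Mh_def sample_covE cov_Y.
  have := moment_success (rshift p i) (rshift p j) ok.
  by under eq_bigr do rewrite !col_mxEd; move/ltW.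
- move=> i j; rewrite sample_covE cross_cov_XY.
  have := moment_success (lshift r i) (rshift p j) ok.
  by under eq_bigr do rewrite col_mxEu col_mxEd; move/ltW.
- exact: cross_cov_le.
- by have := Eh_def x; rewrite Uh_def (sample_cov_tr (Xs ^~ x)).
Qed.

End OneSample.

(** * Convergence in probability along the sequence of models *)

Theorem corollary3 (R : realType) (p d u : nat) (sigma : R)
  (n r : nat -> nat)
  (disp : nat -> measure_display) (T : forall k, measurableType (disp k))
  (P : forall k, probability (T k) R)
  (X : forall k, T k -> 'cV[R]_p)
  (Y eps : forall k, T k -> 'cV[R]_(r k))
  (alpha : forall k, 'cV[R]_(r k)) (beta : forall k, 'M[R]_(r k, p))
  (Xs : forall k, 'I_(n k) -> T k -> 'cV[R]_p)
  (Ys : forall k, 'I_(n k) -> T k -> 'cV[R]_(r k))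
  (M U E : forall k, 'M[R]_(r k))
  (lam : forall k, 'I_(r k) -> R) (v : forall k, 'I_(r k) -> 'cV[R]_(r k))
  (Mh Uh Eh : forall k, T k -> 'M[R]_(r k))
  (tau DeltaU : nat -> R)
  (n_infty : n @ \oo --> \oo) (r_infty : r @ \oo --> \oo)
  (sigma_gt0 : 0 < sigma)
  (X_rv : forall k, random_vector (X k)) (Y_rv : forall k, random_vector (Y k))
  (model : forall k x, Y k x = alpha k + beta k *m X k x + eps k x)
  (eps_indep : forall k, independent_vectors (P k) (eps k) (X k))
  (EX0 : forall k, centered (P k) (X k)) (EY0 : forall k, centered (P k) (Y k))
  (subG : forall k,
    sub_gaussian (P k) sigma (fun x => col_mx (X k x) (Y k x)))
  (sample : forall k, iid_copies (P k) (fun x => col_mx (X k x) (Y k x))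
                        (fun i x => col_mx (Xs k i x) (Ys k i x)))
  (M_def : forall k, M k = cross_cov (P k) (Y k) (Y k))
  (M_posdef : forall k, posdef (M k))
  (U_def : forall k,
    U k = cross_cov (P k) (Y k) (X k) *m cross_cov (P k) (X k) (Y k))
  (Mh_def : forall k x, Mh k x = sample_cov (Ys k ^~ x) (Ys k ^~ x))
  (Uh_def : forall k x, Uh k x =
    sample_cov (Ys k ^~ x) (Xs k ^~ x) *m sample_cov (Xs k ^~ x) (Ys k ^~ x))
  (eig : forall k, eigensystem (M k) (lam k) (v k))
  (E_def : forall k, E k = envelope (M k) (U k))
  (u_gt0 : (0 < u)%N) (dimE : forall k, \rank (E k) = u)
  (d_lt_r : forall k, (d < r k)%N)
  (E_sub : forall k, (E k <= \sum_(j < r k | (j < d)%N) <<(v k j)^T>>)%MS)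
  (gap : exists2 delta : R, 0 < delta &
    forall k (i j : 'I_(r k)), (i < d)%N -> j = i.+1 :> nat ->
      delta <= lam k i - lam k j)
  (DeltaU_def : forall k, DeltaU k = score_gap d u (U k) (v k))
  (tau_gt : forall k, max_l1norm d (v k) < tau k)
  (Eh_def : forall k x, sparse_NIECE d u (tau k) (Mh k x) (Uh k x) (Eh k x))
  (log_r : (fun k => ln (r k)%:R : R^o) =o_\oo (fun k => (n k)%:R : R^o))
  (rate : (fun k =>
      Num.max (tau k ^+ 2 * Num.sqrt (ln (r k)%:R))
              (DeltaU k ^- 2 * tau k ^+ 2 * Num.sqrt (ln (r k)%:R)) : R^o)
    =o_\oo (fun k => Num.sqrt (n k)%:R : R^o)) :
  cvg0_in_prob P (fun k x => frobenius (orthproj (Eh k x) - orthproj (E k))).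
Proof.
have [delta delta_gt0 gapk] := gap.
pose L : R := 4 * exp_tail_const R * sigma ^+ 2.
pose C := PMD_const L delta d.
pose D := deviation_const sigma.
pose a : R := (2 * sigma ^+ 2)^-1.
pose G := p%:R * (2 * L + 1 + 4 * L ^+ 2 * Num.sqrt C).
(* Makes [n t^2 / (4 D) = 3 ln r]: each entry fails with probability at most [2 r^-3], which beats
   the union over [(p + r)^2] entries. *)
pose K := Num.sqrt (12 * D).
have s2 : 0 < sigma ^+ 2 by exact: exprn_gt0.
have a0 : 0 < a by rewrite invr_gt0 mulr_gt0.
have D0 : 0 < D by exact: deviation_const_gt0.
have L0 : 0 <= L by rewrite mulr_ge0 ?(ltW s2)// mulr_ge0// exp_tail_const_ge0.
have C0 : 0 <= C by exact: PMD_const_ge0.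
have G0 : 0 <= G.
  apply: mulr_ge0 => //; apply: addr_ge0.
    by apply: addr_ge0 => //; exact: mulr_ge0.
  by apply: mulr_ge0 (sqrtr_ge0 _); apply: mulr_ge0 => //; exact: sqr_ge0.
have K0 : 0 < K by rewrite sqrtr_gt0 mulr_gt0.
have K2 : K ^+ 2 = 12 * D by rewrite sqr_sqrtr// mulr_ge0// ltW.
pose t k := K * Num.sqrt (ln (r k)%:R) / Num.sqrt (n k)%:R.
move=> e e0.
have e2 : 0 < e ^+ 2 by exact: exprn_gt0.
(* With [q1 c <= 1] the score perturbation is at most [DeltaU / 3]; with [q2 c <= 1] the squared
   error is at most [e^2 / 2]; with [K c <= 1] the error [eta] is at most 1. *)
pose q1 := 9 * G ^+ 2 * K.
pose q2 := 4 * (u%:R * C) * K / e ^+ 2.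
have q1_ge0 : 0 <= q1 by rewrite mulr_ge0 ?(ltW K0)// mulr_ge0 ?sqr_ge0.
have q2_ge0 : 0 <= q2.
  apply: divr_ge0; last exact: ltW.
  by apply: mulr_ge0; [apply: mulr_ge0 => //; exact: mulr_ge0|exact: ltW].
pose c := (1 + K + q1 + q2)^-1.
have c0 : 0 < c by rewrite invr_gt0 !ltr_wpDr// ltW.
have cE : (1 + K + q1 + q2) * c = 1 by rewrite divff// gt_eqF// -invr_gt0.
have [cK cq1 cq2] : [/\ K * c <= 1, q1 * c <= 1 & q2 * c <= 1].
  have := ltW (mulr_gt0 K0 c0); have := mulr_ge0 q1_ge0 (ltW c0).
  have := mulr_ge0 q2_ge0 (ltW c0); split; lra.
have tail k : (0 < r k)%N -> (0 < n k)%N -> t k <= a * D ->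
    tau k ^+ 2 * t k <= K * c -> tau k ^+ 2 * t k <= K * c * DeltaU k ^+ 2 ->
    (mu_ext (P k) [set x | (e <= `|frobenius (orthproj (Eh k x) - orthproj (E k))|)%R]
      <= (2 * (p%:R + 1) ^+ 2 / (r k)%:R)%:E)%E.
  move=> r0 n0 ta eta1 eta2.
  have t0 : 0 <= t k by rewrite divr_ge0 ?sqrtr_ge0// mulr_ge0 ?sqrtr_ge0// ltW.
  have mZ := measurable_col_mx (X_rv k) (Y_rv k).
  have Delta0 := score_gap_gt0 (M_posdef k) (U_def k)
    (eig k) (E_def k) u_gt0 (dimE k) (E_sub k) delta_gt0 (gapk k).
  have [mF PF] := moment_failureP sigma_gt0 mZ (subG k) (sample k) n0 t0 ta.
  set F := moment_failure _ _ _ _ in mF PF.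
  apply: (@le_trans _ _ (mu_ext (P k) F)).
    (* Off [F] the deterministic bound keeps the error below [e], so the bad set lies in the
       measurable set [F]. *)
    apply: le_mu_ext => x /= ex; apply: contrapT => nF.
    have eta0 : 0 <= tau k ^+ 2 * t k by rewrite mulr_ge0 ?sqr_ge0.
    have := @frobenius_success R _ _ _ _ _ _ _ _ sigma delta (tau k) (X k) (Y k)
      (Xs k) (Ys k) (M k) (U k) (E k) (lam k) (v k) (Mh k) (Uh k) (Eh k)
      sigma_gt0 (X_rv k) (Y_rv k) (EX0 k) (EY0 k) (subG k) (M_def k)
      (M_posdef k) (U_def k) (Mh_def k) (Uh_def k) (eig k) (E_def k) u_gt0
      (dimE k) (d_lt_r k) (E_sub k) delta_gt0 (gapk k) (tau_gt k) (Eh_def k)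
      (t k) x nF (le_trans eta1 cK).
    rewrite -DeltaU_def -/L -/C -/G => H.
    have /H{H} Hf : G * Num.sqrt (tau k ^+ 2 * t k) <= DeltaU k / 3.
      have D3 : 0 <= DeltaU k / 3 by rewrite divr_ge0// DeltaU_def ltW.
      have Gs0 : 0 <= G * Num.sqrt (tau k ^+ 2 * t k).
        by apply: mulr_ge0 => //; exact: sqrtr_ge0.
      rewrite -ler_sqr ?nnegrE// exprMn sqr_sqrtr//.
      have h1 := ler_wpM2l (sqr_ge0 G) eta2.
      have h2 := ler_wpM2r (sqr_ge0 (DeltaU k)) cq1.
      by apply: le_trans h1 _; move: h2; rewrite /q1; lra.
    have ef : e ^+ 2 <= frobenius (orthproj (Eh k x) - orthproj (E k)) ^+ 2.
      by rewrite -(real_normK (num_real (frobenius _))) ler_sqr ?nnegrE ?(ltW e0).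
    have uC0 : 0 <= u%:R * C by exact: mulr_ge0.
    have h1 := ler_wpM2l uC0 eta1.
    have h2 : 4 * (u%:R * C) * K * c <= e ^+ 2.
      by move: cq2; rewrite /q2 mulrAC ler_pdivrMr// mul1r.
    by lra.
  rewrite measurable_mu_extE//; apply: le_trans PF _; rewrite lee_fin.
  have rp : 0 < (r k)%:R :> R by rewrite ltr0n.
  have r1 : 1 <= (r k)%:R :> R by rewrite ler1n.
  have np : 0 < (n k)%:R :> R by rewrite ltr0n.
  have -> : (n k)%:R * t k ^+ 2 / (4 * deviation_const sigma) = 3%:R * ln (r k)%:R.
    rewrite -/D /t expr_div_n exprMn K2 !sqr_sqrtr ?ln_ge0 ?(ltW np)//.
    by field; rewrite !gt_eqF.
  rewrite expRN expRM_natl lnK ?posrE// natrM -expr2 natrD.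
  have h : (p%:R + (r k)%:R) ^+ 2 <= ((p%:R + 1) * (r k)%:R) ^+ 2 :> R.
    rewrite ler_sqr ?nnegrE ?addr_ge0 ?mulr_ge0 ?addr_ge0// mulrDl mul1r lerD2r.
    by rewrite ler_peMr.
  rewrite (_ : 2 * (p%:R + 1) ^+ 2 / (r k)%:R
    = ((p%:R + 1) * (r k)%:R) ^+ 2 * (2 / (r k)%:R ^+ 3)); last first.
    by field; rewrite gt_eqF.
  by rewrite ler_wpM2r// divr_ge0// exprn_ge0.
pose b k : R := 2 * (p%:R + 1) ^+ 2 / (r k)%:R.
have b0 : b @ \oo --> (0 : R).
  apply/cvgrPdist_le => x x0.
  have B0 : 0 <= 2 * (p%:R + 1) ^+ 2 :> R by rewrite mulr_ge0 ?sqr_ge0.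
  have r_large : \forall k \near \oo,
      ((Num.trunc (2 * (p%:R + 1) ^+ 2 / x : R)).+1 <= r k)%N.
    exact: r_infty (nbhs_infty_ge _).
  apply: filterS r_large => k rk.
  have rx : 2 * (p%:R + 1) ^+ 2 / x < (r k)%:R.
    by apply: lt_le_trans (truncnS_gt _) _; rewrite ler_nat.
  have rp : 0 < (r k)%:R :> R by apply: le_lt_trans rx; rewrite divr_ge0// ltW.
  rewrite sub0r normrN ger0_norm ?divr_ge0 ?(ltW rp)// ler_pdivrMr//.
  by rewrite ltr_pdivrMr// in rx; rewrite (mulrC x) ltW.
apply: (@squeeze_cvge _ _ _ _ (fun=> 0%E) _ (fun k => (b k)%:E)); last 2 first.
- exact: cvg_cst.
- by apply: cvg_EFin => //; exact: nearW.
move/eqoP: rate => /(_ c c0) rate_c.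
(* [ln r <= (a D / K)^2 n] is exactly [t <= a D], the range where the Chernoff bound holds. *)
have w0 : 0 < (a * D / K) ^+ 2 by rewrite exprn_gt0// divr_gt0// mulr_gt0.
move/eqoP: log_r => /(_ _ w0) log_c.
have n_pos : \forall k \near \oo, (0 < n k)%N := n_infty _ (nbhs_infty_gt 0).
apply: filterS3 rate_c log_c n_pos => k /= rate_k log_k n0.
have r0 : (0 < r k)%N by exact: leq_ltn_trans (d_lt_r k).
have np : 0 < Num.sqrt (n k)%:R :> R by rewrite sqrtr_gt0 ltr0n.
have ln0 : 0 <= ln (r k)%:R :> R by rewrite ln_ge0// ler1n.
have Delta0 : 0 < DeltaU k.
  rewrite DeltaU_def.
  exact: score_gap_gt0 (M_posdef k) (U_def k) (eig k) (E_def k) u_gt0 (dimE k)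
    (E_sub k) delta_gt0 (gapk k).
have Delta2 : 0 < DeltaU k ^+ 2 by exact: exprn_gt0.
move: rate_k; rewrite (gtr0_norm np) => /(le_trans (ler_norm _)).
rewrite ge_max => /andP[rate1 rate2].
have eta c1 : tau k ^+ 2 * Num.sqrt (ln (r k)%:R) <= c1 * Num.sqrt (n k)%:R ->
    tau k ^+ 2 * t k <= K * c1.
  by move=> h; rewrite /t -(mulrA K) mulrCA ler_pM2l// mulrA ler_pdivrMr.
apply/andP; split; first exact: mu_ext_ge0.
apply: (tail k) => //.
- rewrite ger0_norm// ger0_norm// in log_k.
  rewrite /t ler_pdivrMr// -ler_pdivlMl// mulrA (mulrC K^-1).
  have q0 : 0 <= a * D / K by rewrite divr_ge0 ?(ltW K0)// mulr_ge0// ltW.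
  rewrite -[a * D / K]ger0_norm// -sqrtr_sqr -sqrtrM ?sqr_ge0//.
  exact: ler_wsqrtr.
- exact: eta.
- rewrite -mulrA; apply: eta.
  (* Multiplying the second rate by [DeltaU^2] clears the negative power and gives the smallness
     relative to the score gap. *)
  have := ler_wpM2l (ltW Delta2) rate2.
  rewrite -(mulrA (DeltaU k ^- 2)) mulVKf ?gt_eqF// => H; apply: le_trans H _.
  by rewrite mulrA (mulrC c).
Qed.
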